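(* Let $N,T\ge 1$ be integers and let $\mathbb{Z}^N=(\mathbb{V},\mathbb{E})$ be the lattice graph with unit weights. Let $V:\mathbb{V}\to\mathbb{R}$ and $f:\mathbb{V}\times\mathbb{R}\to\mathbb{R}$, put $F(x,u):=\int_0^u f(x,s)\,ds$, and suppose that: (1) $V$ is bounded and $T$-periodic, and $0$ lies in a gap of the spectrum of $-\Delta+V$; (2) $f$ is continuous, $T$-periodic in $x$, and there are $a>0$ and $p>2$ with $|f(x,u)|\le a(|u|+|u|^{p-1})$ for all $x\in\mathbb{V}$, $u\in\mathbb{R}$; (3) $f(x,u)=o(u)$ as $u\to0$, uniformly in $x$; (4) $F(x,u)/u^2\to\infty$ as $|u|\to\infty$, uniformly in $x$; (5) for every $x\in\mathbb{V}$, $u\mapsto f(x,u)/|u|$ is strictly increasing on $(-\infty,0)$ and on $(0,+\infty)$. Then the problem $$-\Delta u+V(x)u=f(x,u)\ \text{ on }\mathbb{V},\qquad u\in W^{1,2}(\mathbb{V}),$$ admits a ground state solution.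
   Context: $\mathbb{V}=\{x=(x_1,\dots,x_N):x_i\in\mathbb{Z}\}$, and $x\sim y$ (neighbours) iff $\sum_{i=1}^N|x_i-y_i|=1$; $\mathbb{E}$ is the set of pairs of neighbours. All edge weights and vertex measures equal $1$, so $\int_{\mathbb{V}}g\,d\mu=\sum_{x\in\mathbb{V}}g(x)$. For $u:\mathbb{V}\to\mathbb{R}$, $\Delta u(x)=\sum_{y\sim x}(u(y)-u(x))$ and $|\nabla u|^2(x)=\frac12\sum_{y\sim x}(u(y)-u(x))^2$. $W^{1,2}(\mathbb{V})$ is the completion of the finitely supported functions in the norm $\|u\|_{W^{1,2}}=\left(\int_{\mathbb{V}}(|\nabla u|^2+u^2)\,d\mu\right)^{1/2}$; as a set with equivalent norm it equals $\ell^2(\mathbb{V})$. A function $g$ on $\mathbb{V}$ is $T$-periodic if $g(x+Te_i)=g(x)$ for all $x\in\mathbb{V}$ and $1\le i\le N$, where $e_i$ is the $i$-th coordinate unit vector. The operator $-\Delta+V$ is regarded as a bounded self-adjoint operator on $\ell^2(\mathbb{V})$. ''$0$ lies in a gap of the spectrum'' means that $0\notin\sigma(-\Delta+V)$ and $\sigma(-\Delta+V)$ meets both $(-\infty,0)$ and $(0,+\infty)$. The variational functional on $W^{1,2}(\mathbb{V})$ is $$\Phi(u)=\frac12\int_{\mathbb{V}}(|\nabla u|^2+V(x)u^2)\,d\mu-\int_{\mathbb{V}}F(x,u)\,d\mu .$$ Its critical points are exactly the solutions of the problem. A ground state solution is a nontrivial solution $u_0\ne0$ whose value $\Phi(u_0)$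 is minimal among the values of $\Phi$ at all nontrivial critical points (nontrivial solutions). *)

(* Defs.v *)
From HB Require Import structures.
From mathcomp Require Import all_boot all_order all_algebra.
From mathcomp Require Import all_classical all_reals all_analysis.

Set Implicit Arguments.
Unset Strict Implicit.
Unset Printing Implicit Defensive.

Import Order.TTheory GRing.Theory Num.Theory.
Import numFieldNormedType.Exports.

Local Open Scope classical_set_scope.
Local Open Scope ring_scope.

Definition lattice (N : nat) := 'rV[int]_N.

HB.instance Definition _ N := GRing.Zmodule.on (lattice N).
HB.instance Definition _ N := Countable.on (lattice N).
HB.instance Definition _ N := isPointed.Build (lattice N) 0.
HB.instance Definition _ N := @isMeasurable.Build default_measure_display
  (lattice N) discrete_measurable discrete_measurable0
  discrete_measurableC discrete_measurableU.

Definition neighbour N (x y : lattice N) : bool :=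
  \sum_(i < N) `|x 0 i - y 0 i| == 1.

(* Sums [\sum_(y \in A) F y] over a classical set are 0 by convention when F
   has infinite support in A; this lemma rules that case out below. *)
Lemma finite_neighbour N (x : lattice N) : finite_set [set y | neighbour x y].
Proof.
pose h (g : {ffun 'I_N -> 'I_3}) : lattice N :=
  \row_i (x 0 i + 1 - (g i : nat)%:Z).
apply: (@sub_finite_set _ _ (h @` [set: {ffun 'I_N -> 'I_3}])); last first.
  exact/finite_image/finite_finset.
move=> y /= /eqP xy.
have le1 i : `|x 0 i - y 0 i| <= 1.
  by rewrite -xy (bigD1 i) //= lerDl; apply: sumr_ge0.
exists [ffun i : 'I_N => inord (absz (x 0 i + 1 - y 0 i)%R)] => //.
apply/rowP => i; rewrite mxE ffunE.
have := le1 i; rewrite ler_norml => /andP[h1 h2].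
have h0 : 0 <= x 0 i + 1 - y 0 i by rewrite addrAC -lerBlDr sub0r.
rewrite inordK; first by rewrite gez0_abs // opprB addrC subrK.
by rewrite ltnS -lez_nat gez0_abs // addrAC -lerBrDr.
Qed.

Section Definitions.
Context {R : realType} {N : nat}.
Implicit Types (u v V : lattice N -> R) (f : lattice N -> R -> R).

Definition lattice_periodic {A : Type} (T : nat) (g : lattice N -> A) : Prop :=
  forall (x : lattice N) (i : 'I_N),
    g (x + (delta_mx 0 i : lattice N) *+ T) = g x.

Definition laplacian u (x : lattice N) : R :=
  \sum_(y \in [set y | neighbour x y]) (u y - u x).

Definition grad_sq u (x : lattice N) : R :=
  2^-1 * \sum_(y \in [set y | neighbour x y]) (u y - u x) ^+ 2.

Definition W12_norm u : \bar R :=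
  ((\int[counting]_x (grad_sq u x + u x ^+ 2)%:E) `^ 2^-1)%E.

(* The completion of the finitely supported functions, realised as a space of
   functions: convergence in the norm implies pointwise convergence. *)
Definition W12 u : Prop :=
  forall e : R, 0 < e -> exists v : lattice N -> R,
    finite_set [set x | v x != 0] /\ (W12_norm (u \- v)%R < e%:E)%E.

Definition ell2 u : Prop := u \in Lfun counting 2%:E.

Definition ell2_norm u : R := fine ('N[counting]_(2%:E) [EFin \o u]).

Definition schrodinger V u : lattice N -> R :=
  fun x => - laplacian u x + V x * u x.

(* Linearity of the inverse B is automatic when A is linear. *)
Definition resolvent_set (A : (lattice N -> R) -> (lattice N -> R)) : set R :=
  [set l | exists B : (lattice N -> R) -> (lattice N -> R),
    [/\ forall v, ell2 v -> ell2 (B v),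
        exists C : R, forall v, ell2 v -> ell2_norm (B v) <= C * ell2_norm v,
        forall v, ell2 v -> A (B v) \- l \*: B v = v
      & forall u, ell2 u -> B (A u \- l \*: u) = u]].

(* For a self-adjoint A, the spectrum on the complexified space is real and
   agrees with the one computed here on real sequences. *)
Definition spectrum (A : (lattice N -> R) -> (lattice N -> R)) : set R :=
  ~` resolvent_set A.

Definition zero_in_spectral_gap V : Prop :=
  let sigma := spectrum (schrodinger V) in
  [/\ ~ sigma 0, exists2 l, l < 0 & sigma l & exists2 l, 0 < l & sigma l].

Definition primitive f (x : lattice N) (t : R) : R :=
  if 0 <= t then \int[lebesgue_measure]_(s in `[0, t]) f x s
  else - \int[lebesgue_measure]_(s in `[t, 0]) f x s.

Definition energy V f u : R :=
  2^-1 * \int[counting]_x (grad_sq u x + V x * u x ^+ 2)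
  - \int[counting]_x primitive f x (u x).

Definition solution V f u : Prop :=
  W12 u /\ forall x, - laplacian u x + V x * u x = f x (u x).

Definition ground_state V f u : Prop :=
  [/\ solution V f u, u <> cst 0
    & forall v, solution V f v -> v <> cst 0 -> energy V f u <= energy V f v].

End Definitions.

(* Main.v *)
Require Import Defs.
From HB Require Import structures.
From mathcomp Require Import all_boot all_order all_algebra.
From mathcomp Require Import all_classical all_reals all_analysis.
From mathcomp Require Import ring lra.

Set Implicit Arguments.
Unset Strict Implicit.
Unset Printing Implicit Defensive.

Import Order.TTheory GRing.Theory Num.Theory.
Import numFieldNormedType.Exports.

Local Open Scope classical_set_scope.
Local Open Scope ring_scope.

(* Let A = - Delta + V. As 0 is not in the spectrum, B = A^-1 is bounded on
   l2; as f(x,t)/|t| is increasing, f(x,.) is an increasing homeomorphism with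
   an inverse phi(x,.). In the dual variable w = A u = f(x,u) solutions are the
   critical points of
     J(w) = sum_x F^*(x, w x) - <B w, w> / 2,
   F^* being the Legendre transform of F. Each ray in {<B w, w> > 0} meets the
   Nehari set {w <> 0, sum_x phi(x, w x) w x = <B w, w>} at the maximum of J on
   that ray, and on this set J is the sum of the densities
   f(x,u) u / 2 - F(x,u) > 0 at u = phi(x, w x). Hence sublevel sets of J on
   the Nehari set are bounded in l2 and do not vanish in the sup norm. After
   translation by periods, a minimizing sequence w_n converges pointwise, along
   an ultrafilter, to some w <> 0. Perturbing w_n at a single site and returning
   to the Nehari set along the ray changes J by a quantity involving only that
   site and (B w_n) there; in the limit this gives phi(x, w x) = (B w) x. So
   u = B w is a solution, and by Fatou its energy is at most the infimum of J
   over the Nehari set, which contains f(x,v) for every solution v <> 0. The set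
   is nonempty because the spectrum meets (0,+oo): were A nonpositive, A - l
   would be invertible for each l > 0. *)

(** * Sums over the lattice *)

Section LatticeSums.
Context {R : realType} {N : nat}.
Implicit Types h k : lattice N -> R.

(** The form <A u, u> is indefinite, so a Nehari constraint for Φ would have to involve the whole
    negative spectral subspace. In J the operator enters through a bounded form set against the
    convex F^*, and one condition per ray is enough. The price is a loss of regularity: f(x,t) =
    o(t) makes phi(x,t)/t blow up at 0, so the sum of F^* can diverge on l2 and J cannot be
    differentiated there. Changing one site alters each Legendre sum by one term, so it stays inside
    the domain of J. Returning to the Nehari set needs a scale s close to 1 uniformly in n. The
    differences s phi(w)w - phi(sw)w have one sign at all sites, so the single difference at a site
    where the limit does not vanish already controls the whole sum and traps s near 1. Since A has
    finite range, pointwise convergence suffices for its equation, and ultrafilter limits take the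
    place of weak compactness. *)

Definition lsum h : R := \int[counting]_x h x.

(** [fine] sends infinite integrals to 0, so [lsum] takes a default value on nonsummable families;
    linearity and comparison of sums therefore carry this hypothesis. *)
Definition lsummable h : Prop :=
  (@counting (lattice N) R).-integrable setT (EFin \o h).

Lemma lattice_measurable (A : set (lattice N)) : measurable A.
Proof. by []. Qed.

Lemma lattice_measurable_fun d (S : sigmaRingType d) (D : set (lattice N))
    (h : lattice N -> S) : measurable_fun D h.
Proof. by move=> _ Y _; exact: lattice_measurable. Qed.
Hint Resolve lattice_measurable_fun : core.

Lemma eq_lsum h k : h =1 k -> lsum h = lsum k.
Proof. by move=> hk; rewrite (funext hk). Qed.

Lemma eq_lsummable h k : h =1 k -> lsummable h -> lsummable k.
Proof. by move=> hk; rewrite (funext hk). Qed.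

Lemma le_lsummable h k : (forall x, `|h x| <= `|k x|) -> lsummable k -> lsummable h.
Proof.
move=> hk; apply: le_integrable => //.
by move=> x _ /=; rewrite lee_fin.
Qed.

Lemma ge0_le_lsummable h k : (forall x, 0 <= h x <= k x) -> lsummable k -> lsummable h.
Proof.
move=> hk; apply: le_lsummable => x; have /andP[h0 hkx] := hk x.
by rewrite !ger0_norm// (le_trans h0).
Qed.

Lemma lsummableZ c h : lsummable h -> lsummable (fun x => c * h x).
Proof. by move=> /(integrableZl measurableT c); apply: eq_integrable. Qed.

Lemma lsummableD h k : lsummable h -> lsummable k -> lsummable (fun x => h x + k x).
Proof. by move=> hs ks; apply: eq_integrable (integrableD _ hs ks). Qed.

Lemma lsummableB h k : lsummable h -> lsummable k -> lsummable (fun x => h x - k x).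
Proof.
move=> hs ks; apply: (@eq_lsummable (fun x => h x + (-1) * k x)).
  by move=> x; rewrite mulN1r.
by apply: lsummableD => //; exact: lsummableZ.
Qed.

Lemma lsumZ c h : lsummable h -> lsum (fun x => c * h x) = c * lsum h.
Proof. by move=> hs; rewrite /lsum RintegralZl. Qed.

Lemma lsumD h k : lsummable h -> lsummable k ->
  lsum (fun x => h x + k x) = lsum h + lsum k.
Proof. by move=> hs ks; rewrite /lsum RintegralD. Qed.

Lemma lsumB h k : lsummable h -> lsummable k ->
  lsum (fun x => h x - k x) = lsum h - lsum k.
Proof. by move=> hs ks; rewrite /lsum RintegralB. Qed.

Lemma le_lsum h k : lsummable h -> lsummable k -> (forall x, h x <= k x) ->
  lsum h <= lsum k.
Proof. by move=> hs ks hk; rewrite /lsum le_Rintegral. Qed.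

Lemma lsum_ge0 h : (forall x, 0 <= h x) -> 0 <= lsum h.
Proof. by move=> h0; apply: Rintegral_ge0. Qed.

Lemma lsummable0 : lsummable (fun=> 0).
Proof. exact: integrable0. Qed.

Lemma lsum0 : lsum (fun=> 0) = 0.
Proof. by rewrite /lsum /Rintegral integral0. Qed.

Lemma counting_set1 (a : lattice N) : counting [set a] = 1%:E :> \bar R.
Proof. by rewrite /counting asboolT// fset_set1 finmap.cardfs1. Qed.

Lemma integral_counting_set1 (a : lattice N) h :
  (\int[counting]_(x in [set a]) (h x)%:E = (h a)%:E)%E.
Proof.
rewrite (@eq_integral _ _ _ _ _ (cst (h a)%:E)); last by move=> x /set_mem ->.
by rewrite integral_cst// [X in (_ * X)%E]counting_set1 mule1.
Qed.

Lemma integral_counting_seq (s : seq (lattice N)) h : uniq s ->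
  (\int[counting]_(x in [set` s]) (h x)%:E = (\sum_(x <- s) h x)%:E)%E.
Proof.
move=> us; rewrite -[in LHS](_ : \big[setU/set0]_(i <- s) [set i] = [set` s]).
  rewrite (@integral_bigsetU_EFin _ _ _ counting _ (fun i : lattice N => [set i]) h s) //.
    rewrite -sumEFin; apply: eq_bigr => i _; exact: integral_counting_set1.
  by move=> i j _ _ [x [/= -> ->]].
by rewrite -bigcup_seq; apply/seteqP; split => [x [y ys ->]//|x xs]; exists x.
Qed.

Lemma ge0_le_seq_lsum h (s : seq (lattice N)) : (forall x, 0 <= h x) -> lsummable h ->
  uniq s -> \sum_(x <- s) h x <= lsum h.
Proof.
move=> h0 hs us; rewrite -lee_fin -integral_counting_seq//.
rewrite /lsum /Rintegral fineK; last exact: integrable_fin_num.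
by apply: ge0_subset_integral => // x _; rewrite lee_fin.
Qed.

Lemma ge0_le_lsum h x : (forall x, 0 <= h x) -> lsummable h -> h x <= lsum h.
Proof. by move=> h0 hs; rewrite -(@big_seq1 _ _ +%R _ x h) ge0_le_seq_lsum. Qed.

(** Numbering the countable lattice by [pickle] gives an increasing exhaustion by finite sets, as
    monotone convergence requires. *)
Let box n : set (lattice N) := [set x | (pickle x < n)%N].

Lemma finite_pickle_lt n : finite_set (box n).
Proof.
apply: (@sub_finite_set _ _ ((fun i => odflt 0 (unpickle i)) @` `I_n)).
  by move=> x /= xn; exists (pickle x) => //; rewrite pickleK.
exact/finite_image/finite_II.
Qed.

(** Monotone convergence along the boxes. Translations and limits are handled through this lemma, by
    looking at finite sums alone. *)
Lemma lsum_le_seq h (C : R) : (forall x, 0 <= h x) ->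
  (forall s, uniq s -> \sum_(x <- s) h x <= C) -> lsummable h /\ lsum h <= C.
Proof.
move=> h0 hC.
have hI : (\int[counting]_x (h x)%:E <= C%:E)%E.
  have -> : [set: lattice N] = \bigcup_n box n.
    by apply/seteqP; split => // x _; exists (pickle x).+1 => //=; rewrite /box/=.
  have cv := @ge0_nondecreasing_set_cvg_integral _ (lattice N) R box (EFin \o h)
    counting.
  have {}cv := cv _ (fun=> lattice_measurable _) (fun=> @lattice_measurable_fun _ _ _ _) _.
  apply: (cvge_to_le (cv _ _)).
  - move=> m n mn; apply/subsetPset => x; rewrite /box /= => xm.
    exact: leq_trans xm mn.
  - by move=> i x _ /=; rewrite lee_fin.
  - apply: nearW => n.
    rewrite -(@fset_setK _ (box n)); last exact: finite_pickle_lt.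
    rewrite integral_counting_seq ?finmap.fset_uniq// lee_fin; apply: hC.
    exact: finmap.fset_uniq.
have hs : lsummable h.
  apply/integrableP; split => //=.
  under eq_integral do rewrite ger0_norm//.
  exact: le_lt_trans hI (ltry _).
split=> //; rewrite -lee_fin /lsum /Rintegral fineK//; exact: integrable_fin_num.
Qed.

End LatticeSums.

(** * Translations, and the inner product and norm of square-summable functions *)

Section SquareSummable.
Context {R : realType} {N : nat}.
Implicit Types h k u v : lattice N -> R.
Local Notation L := (lattice N).

Lemma lsummable_norm h : lsummable h -> lsummable (fun x => `|h x|).
Proof. by apply: le_lsummable => x; rewrite normr_id. Qed.

Lemma ge0_lsum_shift a h : (forall x, 0 <= h x) -> lsummable h ->
  lsummable (fun x => h (x + a)) /\ lsum (fun x => h (x + a)) <= lsum h.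
Proof.
move=> h0 hs; apply: lsum_le_seq => // s us.
rewrite -(big_map (fun x => x + a) xpredT h).
by apply: ge0_le_seq_lsum => //; rewrite (map_inj_uniq (addIr a)).
Qed.

Lemma ge0_lsum_shiftE a h : (forall x, 0 <= h x) -> lsummable h ->
  lsum (fun x => h (x + a)) = lsum h.
Proof.
move=> h0 hs; have [hs' le1] := ge0_lsum_shift a h0 hs.
apply/eqP; rewrite eq_le le1 /=.
have [_] := @ge0_lsum_shift (- a) (fun x => h (x + a)) (fun=> h0 _) hs'.
by apply: le_trans; rewrite le_eqVlt; apply/predU1P; left; apply: eq_lsum => x;
  rewrite subrK.
Qed.

(** Splits a signed h as (|h| + h) - |h|, a difference of nonnegative families. *)
Let normD_ge0 h x : 0 <= `|h x| + h x.
Proof. by have := ler_norm (- h x); rewrite normrN; lra. Qed.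

Lemma lsummable_shift a h : lsummable h -> lsummable (fun x => h (x + a)).
Proof.
move=> hs; have ns := lsummable_norm hs.
have [ns' _] := @ge0_lsum_shift a _ (fun=> normr_ge0 _) ns.
have [ps' _] := @ge0_lsum_shift a _ (normD_ge0 h) (lsummableD ns hs).
by apply: eq_lsummable (lsummableB ps' ns') => x; ring.
Qed.

Lemma lsum_shift a h : lsummable h -> lsum (fun x => h (x + a)) = lsum h.
Proof.
move=> hs; have ns := lsummable_norm hs.
have ps := lsummableD ns hs.
transitivity (lsum (fun x => (`|h (x + a)| + h (x + a)) - `|h (x + a)|)).
  by apply: eq_lsum => x; ring.
rewrite lsumB; [|exact: (lsummable_shift a ps)|exact: (lsummable_shift a ns)].
rewrite (@ge0_lsum_shiftE a (fun x => `|h x| + h x))//.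
rewrite (@ge0_lsum_shiftE a (fun x => `|h x|))//.
by rewrite -lsumB//; apply: eq_lsum => x; ring.
Qed.

Definition site (a : L) : L -> R := fun x => (x == a)%:R.

Lemma lsummable_site a : lsummable (site a) /\ lsum (site a) = 1.
Proof.
have s0 x : 0 <= site a x by rewrite ler0n.
have [sm le1] : lsummable (site a) /\ lsum (site a) <= 1.
  apply: lsum_le_seq => // s us; have [as_|as_] := boolP (a \in s).
    rewrite (bigD1_seq a)//= /site eqxx big1 ?addr0// => i /negPf ->//.
  by rewrite big1_seq// => i /andP[_ is_]; rewrite /site; case: eqP is_ as_ => // -> ->.
split=> //; apply/eqP; rewrite eq_le le1/=.
by have := ge0_le_lsum a s0 sm; rewrite {1}/site eqxx.
Qed.

(** [k] is [h] plus a multiple of [site a]. The effect of a single-site perturbation on the pairing,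
    the ray sums and the Legendre sums is read off from this. *)
Lemma lsum_change a h k : (forall x, x != a -> k x = h x) -> lsummable h ->
  lsummable k /\ lsum k = lsum h + (k a - h a).
Proof.
move=> kh hs; have [ds d1] := lsummable_site a.
have E x : h x + (k a - h a) * site a x = k x.
  rewrite /site; case: eqVneq => [->|/kh ->]; first by rewrite mulr1 addrC subrK.
  by rewrite mulr0 addr0.
split; first by apply: (eq_lsummable E); apply: lsummableD => //; exact: lsummableZ.
rewrite -(eq_lsum E) lsumD ?lsumZ ?d1 ?mulr1//; exact: lsummableZ.
Qed.

Lemma lsummable_finite (s : seq L) h : (forall x, x \notin s -> h x = 0) -> lsummable h.
Proof.
elim: s h => [|a s IH] h hs.
  by apply: eq_lsummable (lsummable0 : lsummable (fun=> 0 : R)) => x; rewrite hs.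
have [] := @lsum_change a (fun x => if x == a then 0 else h x) h => //.
  by move=> x /negPf ->.
apply: IH => x xs; case: eqVneq => // xa.
by apply: hs; rewrite inE (negPf xa).
Qed.

Lemma lsum_sum (I : Type) (s : seq I) (h : I -> L -> R) :
  (forall i, lsummable (h i)) ->
  lsummable (fun x => \sum_(i <- s) h i x) /\
  lsum (fun x => \sum_(i <- s) h i x) = \sum_(i <- s) lsum (h i).
Proof.
move=> hs; elim: s => [|i s [IH1 IH2]].
  rewrite big_nil; split; last by rewrite -[RHS](@lsum0 R N); apply: eq_lsum => x; rewrite big_nil.
  by apply: eq_lsummable (lsummable0 : lsummable (fun=> 0 : R)) => x; rewrite big_nil.
have E x : h i x + \sum_(j <- s) h j x = \sum_(j <- i :: s) h j x by rewrite big_cons.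
split; first by apply: (eq_lsummable E); exact: lsummableD.
by rewrite -(eq_lsum E) lsumD// big_cons IH2.
Qed.

Definition sqsum u : R := lsum (fun x => u x ^+ 2).
Definition dot u v : R := lsum (fun x => u x * v x).
Definition l2 u : Prop := lsummable (fun x => u x ^+ 2).

Lemma sqsum_ge0 u : 0 <= sqsum u.
Proof. by apply: lsum_ge0 => x; exact: sqr_ge0. Qed.

Lemma dotuu u : dot u u = sqsum u.
Proof. by apply: eq_lsum => x; rewrite expr2. Qed.

Lemma dotC u v : dot u v = dot v u.
Proof. by apply: eq_lsum => x; rewrite mulrC. Qed.

Lemma ler_sqr_l2 u v : (forall x, u x ^+ 2 <= v x ^+ 2) -> l2 v ->
  l2 u /\ sqsum u <= sqsum v.
Proof.
move=> uv vs; have us : l2 u.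
  by apply: ge0_le_lsummable vs => x; rewrite sqr_ge0 uv.
by split=> //; exact: le_lsum.
Qed.

Lemma eq_l2 u v : u =1 v -> l2 u -> l2 v.
Proof. by move=> uv; rewrite (funext uv). Qed.

Lemma l2Z c u : l2 u -> l2 (fun x => c * u x).
Proof.
by move=> us; apply: eq_lsummable (lsummableZ (c ^+ 2) us) => x; rewrite exprMn.
Qed.

Lemma sqsumZ c u : l2 u -> sqsum (fun x => c * u x) = c ^+ 2 * sqsum u.
Proof.
by move=> us; rewrite -lsumZ//; apply: eq_lsum => x; rewrite exprMn.
Qed.

Lemma l2M u v : l2 u -> l2 v -> lsummable (fun x => u x * v x).
Proof.
move=> us vs; apply: le_lsummable (lsummableD us vs) => x.
rewrite [leRHS]ger0_norm ?addr_ge0 ?sqr_ge0// ler_norml.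
by apply/andP; split; have := sqr_ge0 (u x + v x); have := sqr_ge0 (u x - v x);
  have := sqr_ge0 (u x); have := sqr_ge0 (v x); nra.
Qed.

Lemma l2D u v : l2 u -> l2 v -> l2 (fun x => u x + v x).
Proof.
move=> us vs.
apply: eq_lsummable (lsummableD (lsummableD us vs) (lsummableZ 2 (l2M us vs))) => x; ring.
Qed.

Lemma l2B u v : l2 u -> l2 v -> l2 (fun x => u x - v x).
Proof.
move=> us vs; apply: eq_l2 (l2D us (l2Z (-1) vs)) => x; by rewrite mulN1r.
Qed.

Lemma sqsumD u v : l2 u -> l2 v ->
  sqsum (fun x => u x + v x) = sqsum u + sqsum v + 2 * dot u v.
Proof.
move=> us vs; rewrite -lsumZ; last exact: l2M.
rewrite -lsumD// -lsumD; [|exact: lsummableD|apply: lsummableZ; exact: l2M].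
by apply: eq_lsum => x; ring.
Qed.

Lemma dotDr u v w : l2 u -> l2 v -> l2 w ->
  dot w (fun x => u x + v x) = dot w u + dot w v.
Proof.
move=> us vs ws; rewrite -lsumD; try exact: l2M.
by apply: eq_lsum => x; ring.
Qed.

Lemma dotBr u v w : l2 u -> l2 v -> l2 w ->
  dot w (fun x => u x - v x) = dot w u - dot w v.
Proof.
move=> us vs ws; rewrite -lsumB; try exact: l2M.
by apply: eq_lsum => x; ring.
Qed.

Lemma dotZr c u w : l2 u -> l2 w -> dot w (fun x => c * u x) = c * dot w u.
Proof.
move=> us ws; rewrite -lsumZ; last exact: l2M.
by apply: eq_lsum => x; ring.
Qed.

Lemma dotDl u v w : l2 u -> l2 v -> l2 w ->
  dot (fun x => u x + v x) w = dot u w + dot v w.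
Proof. by move=> us vs ws; rewrite dotC dotDr// !(dotC w). Qed.

Lemma dotZl c u w : l2 u -> l2 w -> dot (fun x => c * u x) w = c * dot u w.
Proof. by move=> us ws; rewrite dotC dotZr// dotC. Qed.

Lemma dot_le_sq u v : l2 u -> l2 v -> 2 * dot u v <= sqsum u + sqsum v.
Proof.
move=> us vs; rewrite -lsumZ; last exact: l2M.
rewrite -lsumD//; apply: le_lsum.
- by apply: lsummableZ; exact: l2M.
- exact: lsummableD.
- by move=> x; have := sqr_ge0 (u x - v x); nra.
Qed.

Lemma le_sqsum u x : l2 u -> u x ^+ 2 <= sqsum u.
Proof.
by move=> us; apply: (@ge0_le_lsum _ _ (fun x => u x ^+ 2)) => // y; exact: sqr_ge0.
Qed.

Lemma l2_shift a u : l2 u -> l2 (fun x => u (x + a)).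
Proof. exact: (@lsummable_shift a (fun x => u x ^+ 2)). Qed.

Lemma sqsum_shift a u : l2 u -> sqsum (fun x => u (x + a)) = sqsum u.
Proof. exact: (@lsum_shift a (fun x => u x ^+ 2)). Qed.

Lemma l2_finite (s : seq L) u : (forall x, x \notin s -> u x = 0) -> l2 u.
Proof. by move=> us; apply: (@lsummable_finite s) => x /us ->; rewrite expr0n. Qed.

Lemma l2_0 : l2 (fun=> 0 : R).
Proof. by apply: (@l2_finite [::]). Qed.

Lemma l2_site a : l2 (site a).
Proof. by apply: (@l2_finite [:: a]) => x; rewrite inE /site => /negPf ->. Qed.

Lemma dot_site u a : l2 u -> dot u (site a) = u a.
Proof.
move=> us; have [] := @lsum_change a (fun=> 0) (fun x => u x * site a x).
- by move=> x /negPf xa; rewrite /site xa mulr0.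
- exact: lsummable0.
- by move=> _; rewrite /dot => ->; rewrite lsum0 add0r subr0 /site eqxx mulr1.
Qed.

Lemma integral_sqr_fin u : l2 u ->
  (\int[counting]_x (u x ^+ 2)%:E = (sqsum u)%:E)%E.
Proof. by move=> us; rewrite /sqsum /lsum /Rintegral fineK//; exact: integrable_fin_num. Qed.

Lemma lsummable_ge0P h : (forall x, 0 <= h x) ->
  lsummable h <-> (\int[counting]_x (h x)%:E < +oo)%E.
Proof.
move=> h0; have E : (\int[counting]_x `|(h x)%:E| = \int[counting]_x (h x)%:E)%E.
  by apply: eq_integral => x _; rewrite gee0_abs// lee_fin.
split; first by move=> /integrableP[_]; rewrite /= E.
by move=> hy; apply/integrableP; split; [exact: lattice_measurable_fun|rewrite /= E].
Qed.

Lemma Lnorm2E u : ('N[counting]_(2%:E) [EFin \o u] =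
  (\int[counting]_x (u x ^+ 2)%:E) `^ 2^-1)%E.
Proof.
rewrite unlock; congr (_ `^ _)%E; apply: eq_integral => x _ /=.
by rewrite powR_mulrn// real_normK// num_real.
Qed.

Lemma ell2P u : ell2 u <-> l2 u.
Proof.
have -> : ell2 u <-> ('N[counting]_(2%:E) [EFin \o u] < +oo)%E.
  rewrite /ell2; split; first by move=> /sub_Lfun_finLfun; rewrite inE.
  move=> h; rewrite inE; apply/andP; split; rewrite inE//=.
rewrite Lnorm2E /l2 lsummable_ge0P; last by move=> x; exact: sqr_ge0.
split; last exact: poweR_lty.
by apply: lty_poweRy; rewrite invr_neq0.
Qed.

Lemma ell2_norm_sqrt u : l2 u -> ell2_norm u = Num.sqrt (sqsum u).
Proof.
move=> us; rewrite /ell2_norm Lnorm2E integral_sqr_fin//= powR12_sqrt//.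
exact: sqsum_ge0.
Qed.

Lemma ell2_norm_leP u v (C : R) : l2 u -> l2 v -> 0 <= C ->
  (ell2_norm u <= C * ell2_norm v) <-> (sqsum u <= C ^+ 2 * sqsum v).
Proof.
move=> us vs C0; rewrite !ell2_norm_sqrt//.
have -> : C * Num.sqrt (sqsum v) = Num.sqrt (C ^+ 2 * sqsum v).
  by rewrite sqrtrM ?sqr_ge0// sqrtr_sqr ger0_norm.
by rewrite ler_sqrt// mulr_ge0 ?sqr_ge0// sqsum_ge0.
Qed.

End SquareSummable.

(** * The Schroedinger operator *)

Section Operator.
Context {R : realType} {N : nat}.
Implicit Types u v w : lattice N -> R.
Local Notation L := (lattice N).

(** With the neighbours written as [x + d], the Laplacian is a fixed finite combination of
    translations; its bounds and symmetry reduce to those of one translation. *)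
Definition unit_steps : seq L := finmap.enum_fset (fset_set [set y : L | neighbour 0 y]).

Lemma neighbour_shift (x d : L) : neighbour x (x + d) = neighbour 0 d.
Proof.
congr (_ == _); apply: eq_bigr => i _.
by rewrite !mxE opprD addrA subrr.
Qed.

Lemma neighbour_opp (d : L) : neighbour 0 (- d) = neighbour 0 d.
Proof.
congr (_ == _); apply: eq_bigr => i _.
by rewrite !mxE opprK add0r sub0r normrN.
Qed.

Lemma fsum_neighbourE (x : L) (F : L -> R) :
  \sum_(y \in [set y | neighbour x y]) F y = \sum_(d <- unit_steps) F (x + d).
Proof.
rewrite -(@fsbig_finite _ _ _ _ [set y : L | neighbour 0 y] (fun d => F (x + d)));
  last exact: finite_neighbour.
apply: (@reindex_fsbig _ _ _ _ _ (fun d => x + d)); split.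
- by move=> d /=; rewrite neighbour_shift.
- by move=> d e _ _ /addrI.
- by move=> y /= xy; exists (y - x) => /=; rewrite -?(neighbour_shift x) addrC subrK.
Qed.

Lemma sum_unit_steps_opp (F : L -> R) :
  \sum_(d <- unit_steps) F (- d) = \sum_(d <- unit_steps) F d.
Proof.
rewrite -!(@fsbig_finite _ _ _ _ [set y : L | neighbour 0 y]); try exact: finite_neighbour.
apply/esym/reindex_fsbig; split.
- by move=> d /=; rewrite neighbour_opp.
- by move=> d e _ _ /oppr_inj.
- by move=> y /= xy; exists (- y) => /=; rewrite ?neighbour_opp ?opprK.
Qed.

Definition neighbour_sum u : L -> R := fun x => \sum_(d <- unit_steps) u (x + d).

Local Notation n := ((size unit_steps)%:R : R).

Lemma sum_const_seq (I : Type) (s : seq I) (c : R) :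
  \sum_(i <- s) c = (size s)%:R * c.
Proof. by rewrite big_const_seq count_predT iter_addr_0 mulr_natl. Qed.

Lemma laplacianE u x : laplacian u x = neighbour_sum u x - n * u x.
Proof.
rewrite /laplacian (fsum_neighbourE x (fun y => u y - u x)) sumrB; congr (_ - _).
by rewrite sum_const_seq.
Qed.

Lemma schrodingerE V u x : schrodinger V u x = (V x + n) * u x - neighbour_sum u x.
Proof. by rewrite /schrodinger laplacianE; ring. Qed.

Lemma l2_sum (I : Type) (s : seq I) (h : I -> L -> R) :
  (forall i, l2 (h i)) -> l2 (fun x => \sum_(i <- s) h i x).
Proof.
move=> hs; elim: s => [|i s IH].
  by apply: eq_l2 (l2_0 : l2 (fun=> 0 : R)) => x; rewrite big_nil.
by apply: eq_l2 (l2D (hs i) IH) => x; rewrite [RHS]big_cons.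
Qed.

Lemma l2_neighbour_sum u : l2 u -> l2 (neighbour_sum u).
Proof. by move=> us; apply: l2_sum => d; exact: l2_shift. Qed.

Lemma sqr_sum_le (I : Type) (s : seq I) (a : I -> R) :
  (\sum_(i <- s) a i) ^+ 2 <= (size s)%:R * \sum_(i <- s) a i ^+ 2.
Proof.
elim: s => [|i s IH]; first by rewrite !big_nil expr0n mul0r.
rewrite !big_cons /= -natr1.
have S0 : 0 <= \sum_(j <- s) a j ^+ 2 by apply: sumr_ge0 => j _; exact: sqr_ge0.
have C : 2 * a i * (\sum_(j <- s) a j) <=
    (size s)%:R * a i ^+ 2 + \sum_(j <- s) a j ^+ 2.
  rewrite mulr_sumr -sum_const_seq -big_split /= ler_sum // => j _.
  by have := sqr_ge0 (a i - a j); nra.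
nra.
Qed.

Lemma sqsum_neighbour_sum u : l2 u -> sqsum (neighbour_sum u) <= n ^+ 2 * sqsum u.
Proof.
move=> us; have [s1 s2] := @lsum_sum R N _ unit_steps (fun d x => u (x + d) ^+ 2)
  (fun d => l2_shift d us).
apply: (@le_trans _ _ (lsum (fun x => n * \sum_(d <- unit_steps) u (x + d) ^+ 2))).
  apply: le_lsum; [exact: l2_neighbour_sum|exact: lsummableZ|].
  by move=> x; exact: sqr_sum_le.
rewrite lsumZ// s2 (eq_bigr (fun=> sqsum u)).
  by rewrite sum_const_seq; lra.
by move=> d _; exact: sqsum_shift.
Qed.

Lemma dot_neighbour_sum u v : l2 u -> l2 v -> dot (neighbour_sum u) v = dot u (neighbour_sum v).
Proof.
move=> us vs.
have [_ e1] := @lsum_sum R N _ unit_steps (fun d x => u (x + d) * v x)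
  (fun d => l2M (l2_shift d us) vs).
have [_ e2] := @lsum_sum R N _ unit_steps (fun d x => u x * v (x + d))
  (fun d => l2M us (l2_shift d vs)).
transitivity (\sum_(d <- unit_steps) lsum (fun x => u (x + d) * v x)).
  by rewrite -e1; apply: eq_lsum => x; rewrite mulr_suml.
transitivity (\sum_(d <- unit_steps) lsum (fun x => u x * v (x + d))); last first.
  by rewrite -e2; apply: eq_lsum => x; rewrite mulr_sumr.
rewrite -[RHS](sum_unit_steps_opp (fun d => lsum (fun x => u x * v (x + d)))).
apply: eq_bigr => d _.
rewrite -[RHS](@lsum_shift _ _ d); last exact: l2M us (l2_shift _ vs).
by apply: eq_lsum => x; rewrite addrK.
Qed.

Section Potential.
Variables (V : L -> R) (K : R).
Hypothesis VK : forall x, `|V x| <= K.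

Let potential_le x u : ((V x + n) * u x) ^+ 2 <= ((K + n) * u x) ^+ 2.
Proof.
rewrite !exprMn ler_wpM2r ?sqr_ge0// -ler_sqrt ?sqr_ge0// !sqrtr_sqr.
have n0 : 0 <= n by rewrite ler0n.
have K0 : 0 <= K := le_trans (normr_ge0 _) (VK 0).
rewrite [leRHS]ger0_norm ?addr_ge0// (le_trans (ler_normD _ _))//.
by rewrite [`|n|]ger0_norm// lerD2r.
Qed.

Lemma l2_potential u : l2 u -> l2 (fun x => (V x + n) * u x) /\
  sqsum (fun x => (V x + n) * u x) <= (K + n) ^+ 2 * sqsum u.
Proof.
move=> us; rewrite -sqsumZ//; apply: ler_sqr_l2; [by move=> x; exact: potential_le|exact: l2Z].
Qed.

Lemma l2_schrodinger u : l2 u -> l2 (schrodinger V u).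
Proof.
move=> us; apply: eq_l2 (l2B (l2_potential us).1 (l2_neighbour_sum us)) => x.
by rewrite schrodingerE.
Qed.

Lemma sqsum_schrodinger u : l2 u ->
  sqsum (schrodinger V u) <= (2 * (K + n) ^+ 2 + 2 * n ^+ 2) * sqsum u.
Proof.
move=> us; have [p1 p2] := l2_potential us; have h1 := l2_neighbour_sum us.
have h2 := sqsum_neighbour_sum us.
have -> : sqsum (schrodinger V u) = sqsum (fun x => (V x + n) * u x + -1 * neighbour_sum u x).
  by apply: eq_lsum => x; rewrite schrodingerE mulN1r.
rewrite sqsumD//; last exact: l2Z.
have := dot_le_sq p1 (l2Z (-1) h1); rewrite sqsumZ// sqrrN expr1n mul1r; lra.
Qed.

Lemma dot_schrodinger u v : l2 u -> l2 v ->
  dot (schrodinger V u) v = dot u (schrodinger V v).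
Proof.
move=> us vs.
have [pu _] := l2_potential us; have [pv _] := l2_potential vs.
transitivity (dot v (fun x => (V x + n) * u x - neighbour_sum u x)).
  by rewrite dotC; apply: eq_lsum => x; rewrite schrodingerE.
rewrite dotBr//; last exact: l2_neighbour_sum.
rewrite [dot v (neighbour_sum u)]dotC dot_neighbour_sum//.
transitivity (dot u (fun x => (V x + n) * v x - neighbour_sum v x)); last first.
  by apply: eq_lsum => x; rewrite schrodingerE.
rewrite dotBr//; last exact: l2_neighbour_sum.
by congr (_ - _); apply: eq_lsum => x; ring.
Qed.

(** Summation by parts: expanding the squares leaves, for each step, two translates of the square of
    [u], which have equal sums, and a cross term. *)
Lemma lsum_grad_sq u : l2 u -> lsummable (grad_sq u) /\
  lsum (grad_sq u) = n * sqsum u - dot (neighbour_sum u) u.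
Proof.
move=> us; have hs := l2_neighbour_sum us.
have [s1 s2] := @lsum_sum R N _ unit_steps (fun d x => u (x + d) ^+ 2)
  (fun d => l2_shift d us).
have sM := lsummableZ 2 (l2M hs us).
have E x : 2^-1 * (\sum_(d <- unit_steps) u (x + d) ^+ 2 + n * u x ^+ 2 -
    2 * (neighbour_sum u x * u x)) = grad_sq u x.
  rewrite /grad_sq (fsum_neighbourE x (fun y => (u y - u x) ^+ 2)).
  congr (_ * _); rewrite /neighbour_sum mulr_suml mulr_sumr.
  have -> : n * u x ^+ 2 = \sum_(d <- unit_steps) u x ^+ 2.
    by rewrite sum_const_seq.
  rewrite -big_split -sumrB /=; apply: eq_bigr => d _; ring.
have sn := lsummableZ n us.
have ss := lsummableB (lsummableD s1 sn) sM.
split; first by apply: (eq_lsummable E); exact: lsummableZ.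
rewrite -(eq_lsum E) lsumZ// lsumB ?lsumD ?lsumZ//; try exact: lsummableD; try exact: l2M.
rewrite s2 (eq_bigr (fun=> sqsum u)); last by move=> d _; exact: sqsum_shift.
rewrite sum_const_seq.
by rewrite -/(sqsum u) -/(dot (neighbour_sum u) u); field.
Qed.

Lemma lsum_energy u : l2 u ->
  lsum (fun x => grad_sq u x + V x * u x ^+ 2) = dot (schrodinger V u) u.
Proof.
move=> us; have [g1 g2] := lsum_grad_sq us.
have [p1 _] := l2_potential us; have hs := l2_neighbour_sum us.
have s1 := l2M p1 us; have s2 := l2M hs us.
have E x : (V x + n) * u x * u x - n * u x ^+ 2 = V x * u x ^+ 2 by ring.
rewrite (@lsumD _ _ (grad_sq u) (fun x => V x * u x ^+ 2))//; last first.
  by apply: (eq_lsummable E); apply: lsummableB => //; exact: lsummableZ.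
rewrite g2 -(eq_lsum E) lsumB ?lsumZ//; last exact: lsummableZ.
rewrite -/(sqsum u).
transitivity (lsum (fun x => (V x + n) * u x * u x) - dot (neighbour_sum u) u); first ring.
rewrite -lsumB//; apply: eq_lsum => x; rewrite schrodingerE; ring.
Qed.

End Potential.

Lemma grad_sq_ge0 u x : 0 <= grad_sq u x.
Proof.
by rewrite mulr_ge0 ?invr_ge0// (fsum_neighbourE x (fun y => (u y - u x) ^+ 2)) sumr_ge0// => d _;
  exact: sqr_ge0.
Qed.

(** Truncation to finitely many sites that carry all but [e] of the squared norm; the error is then
    a difference of squared norms. *)
Lemma l2_approx u e : l2 u -> 0 < e -> exists v, exists s : seq L,
  [/\ forall x, x \notin s -> v x = 0, l2 v, sqsum v <= sqsum u &
      sqsum (fun x => u x - v x) < e].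
Proof.
move=> us e0.
have [s us_ hs] : exists2 s : seq L, uniq s & sqsum u - e < \sum_(x <- s) u x ^+ 2.
  apply: contrapT => H.
  have H' t : uniq t -> \sum_(x <- t) u x ^+ 2 <= sqsum u - e.
    by move=> ut; rewrite leNgt; apply/negP => h; apply: H; exists t.
  have [_] := @lsum_le_seq _ _ (fun x => u x ^+ 2) _ (fun x => sqr_ge0 _) H'.
  by rewrite -/(sqsum u); lra.
pose v x := if x \in s then u x else 0.
have vs : forall x, x \notin s -> v x = 0 by move=> x /negPf xs; rewrite /v xs.
have v2 := l2_finite vs.
exists v, s; split=> //.
  apply: le_lsum => // x; rewrite /v; case: ifP => // _; rewrite expr0n; exact: sqr_ge0.
have -> : sqsum (fun x => u x - v x) = sqsum u - sqsum v.
  rewrite -lsumB//; apply: eq_lsum => x; rewrite /v; case: ifP => _; ring.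
suff : \sum_(x <- s) u x ^+ 2 <= sqsum v by move: hs; lra.
have -> : \sum_(x <- s) u x ^+ 2 = \sum_(x <- s) v x ^+ 2.
  by apply: eq_big_seq => x xs; rewrite /v xs.
by apply: (@ge0_le_seq_lsum _ _ (fun x => v x ^+ 2)) => // x; exact: sqr_ge0.
Qed.

(** The gradient term is nonnegative, and it is bounded by the [l2] norm because every site has the
    same number of neighbours; so the two norms are equivalent. *)
Lemma W12P u : W12 u <-> l2 u.
Proof.
split=> [/(_ 1 ltr01) [v [vfin]]|us e e0].
  have v2 : l2 v.
    apply: (@l2_finite _ _ (finmap.enum_fset (fset_set [set x | v x != 0]))) => x.
    by rewrite in_fset_set// notin_setE /= => /negP; rewrite negbK => /eqP.
  move=> /lt_trans/(_ (ltry _)); rewrite /W12_norm.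
  move=> /lty_poweRy; rewrite invr_neq0// => /(_ isT).
  move/lsummable_ge0P => /= h.
  have {}h : lsummable (fun x => grad_sq (u \- v) x + (u \- v) x ^+ 2).
    by apply: h => x; rewrite addr_ge0 ?sqr_ge0 ?grad_sq_ge0.
  have d2 : l2 (u \- v).
    apply: ge0_le_lsummable h => x; rewrite sqr_ge0 lerDr; exact: grad_sq_ge0.
  by apply: eq_l2 (l2D d2 v2) => x; rewrite subrK.
(* A crude constant. With [S] the squared [l2] norm of the error, the gradient part is [n * S] minus
   a cross term of size at most [(n ^+ 2 + 1) / 2 * S]. *)
pose c := 2 * n ^+ 2 + 2 * n + 2.
have n0 : 0 <= n by rewrite ler0n.
have c0 : 0 < c by rewrite /c; nra.
have [v [s [vs v2 _ dv]]] := l2_approx us (divr_gt0 (exprn_gt0 2 e0) c0).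
exists v; split.
  apply: (sub_finite_set _ (finite_seq s)) => x /= vx.
  by apply: contraNT vx => /vs ->.
have w2 : l2 (u \- v) := l2B us v2.
have [g1 g2] := lsum_grad_sq w2.
have -> : W12_norm (u \- v) = (Num.sqrt (lsum (grad_sq (u \- v)) + sqsum (u \- v)))%:E.
  rewrite /W12_norm -lsumD//.
  rewrite -powR12_sqrt; last first.
    by apply: lsum_ge0 => x; rewrite addr_ge0 ?sqr_ge0 ?grad_sq_ge0.
  rewrite -poweR_EFin; congr (_ `^ _)%E.
  by rewrite /lsum /Rintegral fineK//; apply: integrable_fin_num => //; exact: lsummableD.
rewrite lte_fin -[ltRHS](ger0_norm (ltW e0)) -sqrtr_sqr ltr_sqrt ?exprn_gt0//.
rewrite g2; have := dot_le_sq (l2Z (-1) (l2_neighbour_sum w2)) w2.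
rewrite dotZl//; last exact: l2_neighbour_sum.
rewrite sqsumZ; last exact: l2_neighbour_sum.
have := sqsum_neighbour_sum w2; have := sqsum_ge0 (u \- v).
have : sqsum (u \- v) * c < e ^+ 2 by rewrite -ltr_pdivlMr.
rewrite /c sqrrN expr1n mul1r; move: (sqsum _) (sqsum _) (dot _ _) => S S' D.
move=> h1 h2 h3 h4; apply: le_lt_trans h1.
have := mulr_ge0 n0 h2; have := mulr_ge0 (mulr_ge0 n0 n0) h2; nra.
Qed.

End Operator.

(** * The nonlinearity at one vertex *)

Section Nonlinearity.
Context {R : realType}.
Implicit Types (f : R -> R) (s t w y : R).

Local Notation mu := (@lebesgue_measure R).

Lemma continuous_itv_integrable f a b : continuous f ->
  mu.-integrable `[a, b] (EFin \o f).
Proof.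
move=> cf; apply: continuous_compact_integrable; first exact: segment_compact.
exact: continuous_subspaceT.
Qed.

(** The body of [primitive] at one vertex; the two are convertible, so hypotheses on [primitive]
    apply to [prim (f x)] as they stand. *)
Definition prim f t : R :=
  if 0 <= t then \int[mu]_(s in `[0, t]) f s
  else - \int[mu]_(s in `[t, 0]) f s.

Lemma itv_int_split f a c b : continuous f -> a <= c -> c <= b ->
  \int[mu]_(s in `[a, b]) f s =
  \int[mu]_(s in `[a, c]) f s + \int[mu]_(s in `[c, b]) f s.
Proof.
move=> cf ac cb.
have := @Rintegral_itvB R f (BLeft a) (BRight b) c (continuous_itv_integrable _ _ cf).
rewrite !bnd_simp => /(_ ac cb) E.
rewrite -(@Rintegral_itv_obnd_cbnd _ c); first by rewrite -E addrC subrK.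
apply: integrableS (continuous_itv_integrable c b cf) => //.
exact: subset_itv_oc_cc.
Qed.

Lemma itv_int_linear k a b : a <= b ->
  \int[mu]_(s in `[a, b]) (k * s) = k * (b ^+ 2 - a ^+ 2) / 2.
Proof.
rewrite le_eqVlt => /predU1P[->|ab].
  by rewrite set_itv1 Rintegral_set1 subrr mulr0 mul0r.
have dF (x : R) : is_derive x 1 (fun s : R => k / 2 * (s ^+ 2)) (k * x).
  by apply: is_derive_eq; rewrite /GRing.scale /=; field.
have cF : continuous (fun s : R => k / 2 * (s ^+ 2)).
  move=> x; apply: differentiable_continuous; apply/derivable1_diffP.
  by have [] := dF x.
have ck : continuous (fun s : R => k * s).
  by move=> x; apply: cvgM; [exact: cvg_cst|exact: cvg_id].
rewrite /Rintegral (@continuous_FTC2 _ _ (fun s : R => k / 2 * (s ^+ 2)))//=; first by field.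
- exact: continuous_subspaceT.
- split.
  + by move=> x _; have [] := dF x.
  + exact/cvg_at_right_filter/cF.
  + exact/cvg_at_left_filter/cF.
- by move=> x _; rewrite derive1E; have [_ ->] := dF x.
Qed.

Lemma le_itv_int f h a b : continuous f -> continuous h ->
  (forall s, a <= s <= b -> f s <= h s) ->
  \int[mu]_(s in `[a, b]) f s <= \int[mu]_(s in `[a, b]) h s.
Proof.
by move=> cf ch fh; apply: le_Rintegral => //; exact: continuous_itv_integrable.
Qed.

Lemma continuous_mulk k : continuous (fun s : R => k * s).
Proof. by move=> x; apply: cvgM; [exact: cvg_cst|exact: cvg_id]. Qed.

Lemma prim0 f : prim f 0 = 0.
Proof. by rewrite /prim lexx set_itv1 Rintegral_set1. Qed.

Lemma primB_pos f a b : continuous f -> 0 <= a -> a <= b ->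
  prim f b - prim f a = \int[mu]_(s in `[a, b]) f s.
Proof.
move=> cf a0 ab; rewrite /prim a0 (le_trans a0 ab) (itv_int_split cf a0 ab).
by rewrite addrC addKr.
Qed.

Lemma primB_neg f a b : continuous f -> b <= 0 -> a <= b ->
  prim f b - prim f a = \int[mu]_(s in `[a, b]) f s.
Proof.
move=> cf b0 ab.
have E x : x <= 0 -> prim f x = - \int[mu]_(s in `[x, 0]) f s.
  rewrite le_eqVlt => /predU1P[->|x0].
    by rewrite prim0 set_itv1 Rintegral_set1 oppr0.
  by rewrite /prim leNgt x0.
rewrite !E// ?(le_trans ab)// (itv_int_split cf ab b0); ring.
Qed.

Record nonlinearity f : Prop := Nonlinearity {
  nl_cont : continuous f;
  nl_zero : forall e, 0 < e -> exists2 d : R, 0 < d &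
    forall t, `|t| < d -> `|f t| <= e * `|t|;
  nl_neg : forall s t, s < t -> t < 0 -> f s / `|s| < f t / `|t|;
  nl_pos : forall s t, 0 < s -> s < t -> f s / `|s| < f t / `|t| }.

Section OneNonlinearity.
Variable f : R -> R.
Hypothesis nf : nonlinearity f.

Lemma nl0 : f 0 = 0.
Proof.
have [d d0 /(_ 0)] := nl_zero nf ltr01; rewrite normr0 mulr0 => /(_ d0).
by rewrite normr_le0 => /eqP.
Qed.

(** Dividing by [t] instead of [|t|] reverses the monotonicity on the negative half-line, so both
    hypotheses say that the quotient grows with [|t|]. *)
Lemma quot_lt s t : 0 < s * t -> `|s| < `|t| -> f s / s < f t / t.
Proof.
have [t0|t0|<-] := ltgtP 0 t; last by rewrite mulr0 ltxx.
- rewrite pmulr_lgt0// => s0; rewrite !gtr0_norm// => st.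
  by have := nl_pos nf s0 st; rewrite !gtr0_norm.
- rewrite nmulr_lgt0// => s0; rewrite !ltr0_norm// ltrN2 => ts.
  by have := nl_neg nf ts s0; rewrite !ltr0_norm// !invrN !mulrN ltrN2.
Qed.

Lemma quot_le s t : 0 < s * t -> `|s| <= `|t| -> f s / s <= f t / t.
Proof.
move=> st; rewrite le_eqVlt => /predU1P[E|]; last by move/(quot_lt st)/ltW.
suff -> : s = t by [].
have [t0|t0|tE] := ltgtP 0 t; last by move: st; rewrite -tE mulr0 ltxx.
- by move: st E; rewrite pmulr_lgt0// => s0; rewrite !gtr0_norm.
- by move: st E; rewrite nmulr_lgt0// => s0; rewrite !ltr0_norm// => /oppr_inj.
Qed.

(** A negative quotient at [t / 2] would become more negative towards 0, against [f t = o(t)].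
    Comparing [t] with [t / 2] turns the resulting weak inequality into a strict one. *)
Lemma quot_gt0 t : t != 0 -> 0 < f t / t.
Proof.
move=> t0; have ht0 : t / 2 != 0 by rewrite mulf_neq0// invr_neq0.
have nt : 0 < `|t| by rewrite normr_gt0.
have nht : `|t / 2| = `|t| / 2 by rewrite normrM [`|2^-1|]ger0_norm.
have st : 0 < t / 2 * t by have := exprn_even_gt0 (n := 2) t (erefl _); rewrite t0 /=; nra.
have lt1 : f (t / 2) / (t / 2) < f t / t by apply: quot_lt => //; rewrite nht; lra.
rewrite (le_lt_trans _ lt1)// leNgt; apply/negP => neg.
set c := f (t / 2) / (t / 2) in lt1 neg.
have nc0 : 0 < - c by rewrite oppr_gt0.
have [d d0 hd] := nl_zero nf nc0.
(* Both bounds serve [s = r / 2 * t]: the first puts [s] closer to 0 than [t / 2], the second puts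
   it where the little-o estimate holds. *)
pose r := Num.min (2^-1) (d / (2 * `|t|)).
have r0 : 0 < r by rewrite lt_min invr_gt0 ltr0n /= divr_gt0// mulr_gt0.
have r12 : r <= 2^-1 by rewrite /r ge_min lexx.
have rd : r * `|t| < d.
  apply: (@le_lt_trans _ _ (d / (2 * `|t|) * `|t|)).
    by rewrite ler_wpM2r// /r ge_min lexx orbT.
  have -> : d / (2 * `|t|) * `|t| = d / 2 by field; rewrite gt_eqF.
  lra.
pose s := r / 2 * t.
have ns : `|s| = r / 2 * `|t| by rewrite normrM gtr0_norm// divr_gt0.
have s0 : s != 0 by rewrite -normr_gt0 ns mulr_gt0// divr_gt0.
have {}hd : `|f s| <= - c * `|s|.
  by apply: hd; rewrite ns; nra.
have lt2 : f s / s < c.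
  apply: quot_lt; last by rewrite ns nht; nra.
  have -> : s * (t / 2) = r / 4 * t ^+ 2 by rewrite /s; field.
  by rewrite mulr_gt0 ?exprn_even_gt0// divr_gt0.
move: hd; rewrite leNgt => /negP; apply.
rewrite -ltr_pdivlMr ?normr_gt0// -normfV -normrM.
by rewrite -normrN (lt_le_trans _ (ler_norm _))// ltrN2.
Qed.

Lemma mul_nl_gt0 t : t != 0 -> 0 < f t * t.
Proof.
move=> t0; have -> : f t * t = f t / t * t ^+ 2 by field.
by rewrite mulr_gt0 ?quot_gt0// exprn_even_gt0.
Qed.

Lemma mul_nl_ge0 t : 0 <= f t * t.
Proof. by have [->|/mul_nl_gt0/ltW//] := eqVneq t 0; rewrite mulr0. Qed.

Lemma nl_gt0 t : 0 < t -> 0 < f t.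
Proof. by move=> t0; have := mul_nl_gt0 (lt0r_neq0 t0); rewrite pmulr_lgt0. Qed.

Lemma nl_lt0 t : t < 0 -> f t < 0.
Proof. by move=> t0; have := mul_nl_gt0 (ltr0_neq0 t0); rewrite nmulr_lgt0. Qed.

(** The line through 0 and [(y, f y)] lies below [f] beyond [y] and above [f] before [y]; the claim
    is the integral of this comparison. *)
Lemma quot_star_pos y y' : 0 < y -> 0 <= y' ->
  f y / y * (y' ^+ 2 - y ^+ 2) / 2 <= prim f y' - prim f y.
Proof.
move=> y0 y'0; have cf := nl_cont nf; have [yy'|/ltW y'y] := leP y y'.
  rewrite primB_pos// ?(ltW y0)// -itv_int_linear//.
  apply: le_itv_int => //; first exact: continuous_mulk.
  move=> s /andP[ys _]; rewrite -ler_pdivlMr ?(lt_le_trans y0)//.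
  apply: quot_le; first by rewrite mulr_gt0// (lt_le_trans y0).
  by rewrite !gtr0_norm// (lt_le_trans y0).
rewrite -lerN2 opprB primB_pos//.
have -> : - (f y / y * (y' ^+ 2 - y ^+ 2) / 2) = f y / y * (y ^+ 2 - y' ^+ 2) / 2 by ring.
rewrite -itv_int_linear//.
apply: le_itv_int => //; first exact: continuous_mulk.
move=> s /andP[y's sy]; have [->|s0] := eqVneq s 0; first by rewrite nl0 mulr0.
have {}s0 : 0 < s by rewrite lt_neqAle eq_sym s0 (le_trans y'0).
by rewrite -ler_pdivrMr//; apply: quot_le; rewrite ?mulr_gt0// !gtr0_norm.
Qed.

Lemma quot_star_neg y y' : y < 0 -> y' <= 0 ->
  f y / y * (y' ^+ 2 - y ^+ 2) / 2 <= prim f y' - prim f y.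
Proof.
move=> y0 y'0; have cf := nl_cont nf; have [yy'|/ltW y'y] := leP y y'.
  rewrite primB_neg// -itv_int_linear//.
  apply: le_itv_int => //; first exact: continuous_mulk.
  move=> s /andP[ys sy]; have [->|s0] := eqVneq s 0; first by rewrite nl0 mulr0.
  have {}s0 : s < 0 by rewrite lt_neqAle s0 (le_trans sy).
  by rewrite -ler_ndivrMr//; apply: quot_le; rewrite ?nmulr_lgt0// !ltr0_norm// lerN2.
rewrite -lerN2 opprB primB_neg// ?(ltW y0)//.
have -> : - (f y / y * (y' ^+ 2 - y ^+ 2) / 2) = f y / y * (y ^+ 2 - y' ^+ 2) / 2 by ring.
rewrite -itv_int_linear//.
apply: le_itv_int => //; first exact: continuous_mulk.
move=> s /andP[y's sy]; have s0 : s < 0 by rewrite (le_lt_trans sy).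
by rewrite -ler_ndivlMr//; apply: quot_le; rewrite ?nmulr_lgt0// !ltr0_norm// lerN2.
Qed.

(* [F] is convex as a function of [t ^ 2] on each half-line. *)
Lemma quot_star y y' : y != 0 -> 0 <= y * y' ->
  f y / y * (y' ^+ 2 - y ^+ 2) / 2 <= prim f y' - prim f y.
Proof.
rewrite neq_lt => /orP[y0|y0].
  by rewrite nmulr_rge0//; exact: quot_star_neg.
by rewrite pmulr_rge0//; exact: quot_star_pos.
Qed.

Lemma prim_ge0 t : 0 <= prim f t.
Proof.
rewrite /prim; case: (leP 0 t) => t0.
  apply: Rintegral_ge0 => s /=; rewrite in_itv/= => /andP[]; rewrite le_eqVlt.
  by move=> /predU1P[<-|/nl_gt0/ltW//]; rewrite nl0.
rewrite oppr_ge0 -oppr_ge0.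
have -> : - (\int[mu]_(s in `[t, 0]) f s) = \int[mu]_(s in `[t, 0]) (-1 * f s).
  by rewrite RintegralZl ?mulN1r//; exact: (continuous_itv_integrable _ _ (nl_cont nf)).
apply: Rintegral_ge0 => s /=; rewrite in_itv/= mulN1r oppr_ge0 => /andP[_].
rewrite le_eqVlt => /predU1P[->|/nl_lt0/ltW//]; by rewrite nl0.
Qed.

Definition energy_density t := 2^-1 * (f t * t) - prim f t.

Lemma energy_density0 : energy_density 0 = 0.
Proof. by rewrite /energy_density !mulr0 prim0 subrr. Qed.

Lemma energy_density_ge0 t : 0 <= energy_density t.
Proof.
have [->|t0] := eqVneq t 0; first by rewrite energy_density0.
have := quot_star t0 (_ : 0 <= t * 0); rewrite mulr0 => /(_ (lexx _)).
rewrite prim0 /energy_density => h.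
have : f t / t * (0 ^+ 2 - t ^+ 2) / 2 = - (2^-1 * (f t * t)) by field.
lra.
Qed.

(** If [0 <= y * y'], this is [quot_star] together with [(y' - y) ^+ 2 >= 0]. Otherwise
    [f y * y' <= 0], and nonnegativity of the energy density suffices. *)
Lemma prim_convex y y' : f y * (y' - y) <= prim f y' - prim f y.
Proof.
have [->|y0] := eqVneq y 0; first by rewrite nl0 mul0r prim0 subr0 prim_ge0.
have [yy'|yy'] := leP 0 (y * y').
  apply: le_trans (quot_star y0 yy').
  have -> : f y * (y' - y) = f y / y * (y * (y' - y)) by field.
  rewrite -[leRHS]mulrA ler_wpM2l//; first exact/ltW/quot_gt0.
  by have := sqr_ge0 (y - y'); nra.
have g0 := energy_density_ge0 y; have p0 := prim_ge0 y'; have q0 := quot_gt0 y0.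
have : f y * y' <= 0.
  have -> : f y * y' = f y / y * (y * y') by field.
  nra.
by have := mul_nl_gt0 y0; rewrite /energy_density in g0; lra.
Qed.

Lemma nl_mono s t : s < t -> f s < f t.
Proof.
move=> st; have [s0|s0] := leP 0 s.
  have t0 := le_lt_trans s0 st.
  have [->|sn0] := eqVneq s 0; first by rewrite nl0 nl_gt0.
  have {}s0 : 0 < s by rewrite lt_neqAle eq_sym sn0.
  have := quot_lt (mulr_gt0 s0 t0); rewrite !gtr0_norm// => /(_ st) h.
  have -> : f s = f s / s * s by field.
  have -> : f t = f t / t * t by field; rewrite gt_eqF.
  by have := quot_gt0 sn0; nra.
have [t0|t0] := leP 0 t.
  apply: (lt_le_trans (nl_lt0 s0)); move: t0; rewrite le_eqVlt.
  by move=> /predU1P[<-|/nl_gt0/ltW//]; rewrite nl0.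
have tn0 : t != 0 by rewrite lt_eqF.
have := @quot_lt t s; rewrite nmulr_rgt0// !ltr0_norm// ltrN2 => /(_ s0 st) h.
have -> : f s = f s / s * s by field; rewrite lt_eqF.
have -> : f t = f t / t * t by field.
by have := quot_gt0 tn0; nra.
Qed.

Lemma nl_le s t : s <= t -> f s <= f t.
Proof. by rewrite le_eqVlt => /predU1P[->//|/nl_mono/ltW]. Qed.

Lemma nl_inj : injective f.
Proof.
by move=> s t E; apply/eqP; case: ltgtP => // /nl_mono; rewrite E ltxx.
Qed.

(** [quot_star] from [t] to [s], with the gain in the quotient kept. Strict positivity, monotonicity
    and coercivity of the density all come from this gain. *)
Lemma energy_density_quot s t : 0 < s * t -> `|s| <= `|t| ->
  (f t / t - f s / s) * s ^+ 2 / 2 <= energy_density t - energy_density s.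
Proof.
move=> st lst; have t0 : t != 0 by apply: contraTneq st => ->; rewrite mulr0 ltxx.
have s0 : s != 0 by apply: contraTneq st => ->; rewrite mul0r ltxx.
have := @quot_star t s t0; rewrite mulrC => /(_ (ltW st)).
rewrite /energy_density; have -> : f t * t = f t / t * t ^+ 2 by field.
have -> : f s * s = f s / s * s ^+ 2 by field.
lra.
Qed.

Lemma energy_density_gt0 t : t != 0 -> 0 < energy_density t.
Proof.
move=> t0; have tt : 0 < t ^+ 2 by rewrite exprn_even_gt0.
have ht : 0 < t / 2 * t by nra.
have nt : 0 < `|t| by rewrite normr_gt0.
have nht : `|t / 2| < `|t| by rewrite normrM [`|2^-1|]ger0_norm//; lra.
have := energy_density_quot ht (ltW nht); have := quot_lt ht nht; have := energy_density_ge0 (t / 2).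
nra.
Qed.

Lemma energy_density_le s t : 0 < s * t -> `|s| <= `|t| -> energy_density s <= energy_density t.
Proof.
move=> st lst; have := energy_density_quot st lst; have := quot_le st lst.
have := sqr_ge0 s; nra.
Qed.

Lemma prim_cont : continuous (prim f).
Proof.
move=> t; apply/cvgrPdist_le => e e0.
(* [f] is increasing, so its values at [t - 1] and [t + 1] bound it in between; the two tangent
   inequalities then make [prim f] Lipschitz near [t] with constant [c]. *)
pose c := Num.max `|f (t + 1)| `|f (t - 1)| + 1.
have c0 : 0 < c by rewrite ltr_pwDr// le_max normr_ge0.
have fc s : `|s - t| <= 1 -> `|f s| <= c.
  rewrite ler_distl => /andP[h1 h2].
  have u1 : f s <= f (t + 1) by apply: nl_le; rewrite addrC; lra.
  have u2 : f (t - 1) <= f s by apply: nl_le; lra.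
  have m1 : `|f (t + 1)| <= c by rewrite /c ler_wpDr// le_max lexx.
  have m2 : `|f (t - 1)| <= c by rewrite /c ler_wpDr// le_max lexx orbT.
  rewrite ler_norml; apply/andP; split.
    apply: le_trans u2; rewrite lerNl; apply: le_trans m2.
    by rewrite -normrN; exact: ler_norm.
  by apply: (le_trans u1); apply: le_trans m1; exact: ler_norm.
have h0 : 0 < Num.min 1 (e / c) by rewrite lt_min ltr01 divr_gt0.
near=> s.
have hs : `|t - s| < Num.min 1 (e / c).
  by near: s; exact: cvgr_dist_lt.
have [hs1 hs2] : `|t - s| <= 1 /\ `|t - s| <= e / c.
  by split; apply: (le_trans (ltW hs)); rewrite ge_min lexx ?orbT.
have a1 : `|f t| <= c by apply: fc; rewrite subrr normr0.
have a2 : `|f s| <= c by apply: fc; rewrite distrC.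
have hc : c * `|t - s| <= e by rewrite mulrC -ler_pdivlMr.
have b1 := prim_convex s t; have b2 := prim_convex t s.
have c1 : `|f s * (t - s)| <= e by rewrite normrM (le_trans _ hc)// ler_wpM2r.
have c2 : `|f t * (s - t)| <= e.
  by rewrite normrM distrC (le_trans _ hc)// ler_wpM2r.
move: c1 c2; rewrite !ler_norml => /andP[c1 _] /andP[c2 _].
by apply/andP; split; lra.
Unshelve. all: by end_near. Qed.

End OneNonlinearity.
End Nonlinearity.

(** * The inverse nonlinearity and its Legendre transform *)

Section Inverse.
Context {R : realType}.
Implicit Types s t w y : R.
Variable f : R -> R.
Hypothesis nf : nonlinearity f.
Hypothesis sf : forall M : R, exists K : R, forall t,
  K < `|t| -> M < prim f t / t ^+ 2.

Lemma quot_gt_prim M t : t != 0 -> M < prim f t / t ^+ 2 -> 2 * M < f t / t.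
Proof.
move=> t0; have tt : 0 < t ^+ 2 by rewrite exprn_even_gt0.
rewrite ltr_pdivlMr// => h; have := energy_density_ge0 nf t; rewrite /energy_density.
have -> : f t * t = f t / t * t ^+ 2 by field.
move=> h2; rewrite -(ltr_pM2r tt); lra.
Qed.

Lemma nl_surj w : exists t, f t = w.
Proof.
have [K hK] := sf 1.
(* At [t0] and [- t0] the quotient [f t / t] exceeds 2, so [f] passes [t0] in absolute value, and
   [t0] dominates [|w|]. *)
pose t0 := `|K| + `|w| + 1.
have t0p : 0 < t0 by rewrite /t0 ltr_wpDl// addr_ge0.
have Kt : K < t0 by rewrite /t0; have := ler_norm K; have := normr_ge0 w; lra.
have [w1 w2] : - t0 <= w /\ w <= t0.
  have := normr_ge0 K; have := ler_norm w; have := ler_norm (- w).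
  by rewrite normrN /t0; split; lra.
have h1 : 2 * 1 < f t0 / t0.
  by apply: quot_gt_prim; rewrite ?gt_eqF//; apply: hK; rewrite gtr0_norm.
have h2 : 2 * 1 < f (- t0) / (- t0).
  apply: quot_gt_prim; first by rewrite oppr_eq0 gt_eqF.
  by apply: hK; rewrite normrN gtr0_norm.
have u1 : t0 <= f t0 by move: h1; rewrite ltr_pdivlMr//; lra.
have u2 : f (- t0) <= - t0 by move: h2; rewrite ltr_ndivlMr ?oppr_lt0//; lra.
have [|||t _ <-] := @IVT R f (- t0) t0 w; last by exists t.
- lra.
- exact/continuous_subspaceT/(nl_cont nf).
- by rewrite ge_min (le_trans u2 w1) le_max (le_trans w2 u1) orbT.
Qed.

(* The inverse of [f]; the default value 0 is never taken since [f] is onto. *)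
Definition phi w : R := xget 0 [set t | f t = w].

Lemma phiK w : f (phi w) = w.
Proof. by have [t ft] := nl_surj w; apply: (xgetPex 0 (P := [set t | f t = w])); exists t. Qed.

Lemma nlK t : phi (f t) = t.
Proof. by apply: (nl_inj nf); rewrite phiK. Qed.

Lemma phi0 : phi 0 = 0.
Proof. by rewrite -{1}(nl0 nf) nlK. Qed.

Lemma phi_lt a b : a < b -> phi a < phi b.
Proof.
by move=> ab; rewrite ltNge; apply/negP => /(nl_le nf); rewrite !phiK leNgt ab.
Qed.

Lemma phi_le a b : a <= b -> phi a <= phi b.
Proof. by rewrite le_eqVlt => /predU1P[->//|/phi_lt/ltW]. Qed.

Lemma phi_eq0 w : (phi w == 0) = (w == 0).
Proof.
apply/eqP/eqP => [h|->]; last exact: phi0.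
by rewrite -(phiK w) h (nl0 nf).
Qed.

Lemma phi_cont : continuous phi.
Proof.
move=> w; apply/cvgrPdist_lt => e e0; near=> v.
have h1 : f (phi w - e) < v.
  by near: v; apply: lt_nbhsr; rewrite -[ltRHS]phiK (nl_mono nf)// gtrBl.
have h2 : v < f (phi w + e).
  by near: v; apply: lt_nbhsl; rewrite -[ltLHS]phiK (nl_mono nf)// ltrDl.
have := phi_lt h1; have := phi_lt h2; rewrite !nlK => g1 g2.
by rewrite ltr_distlC; apply/andP; split.
Unshelve. all: by end_near. Qed.

Lemma phiM_gt0 w : w != 0 -> 0 < phi w * w.
Proof.
by rewrite -phi_eq0 => /(mul_nl_gt0 nf); rewrite phiK mulrC.
Qed.

Lemma phiM_ge0 w : 0 <= phi w * w.
Proof. by have := mul_nl_ge0 nf (phi w); rewrite phiK mulrC. Qed.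

Lemma phi_scale_sign s w : 0 < s -> w != 0 -> 0 < phi (s * w) * phi w.
Proof.
move=> s0 w0; have sw0 : s * w != 0 by rewrite mulf_neq0// gt_eqF.
have h1 := phiM_gt0 sw0; have h2 := phiM_gt0 w0.
have : 0 < (phi (s * w) * (s * w)) * (phi w * w) by rewrite mulr_gt0.
have -> : phi (s * w) * (s * w) * (phi w * w) = (phi (s * w) * phi w) * (s * w ^+ 2) by ring.
by rewrite pmulr_lgt0// mulr_gt0// exprn_even_gt0.
Qed.

Lemma phi_scale_ge s w : 1 <= s -> phi w * w <= phi (s * w) * w.
Proof.
move=> s1; have [w0|w0|->] := ltgtP w 0; last by rewrite !mulr0.
  by rewrite ler_nM2r// phi_le// ger_nMl.
by rewrite ler_pM2r// phi_le// ler_peMl// ltW.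
Qed.

Lemma phi_scale_gt s w : w != 0 -> 1 < s -> phi w * w < phi (s * w) * w.
Proof.
rewrite neq_lt => /orP[] w0 s1.
  by rewrite ltr_nM2r// phi_lt// gtr_nMl.
by rewrite ltr_pM2r// phi_lt// ltr_pMl.
Qed.

(** Scaling up [w] increases [|phi w|], hence the quotient [f y / y] at [y = phi w], which is
    [w / phi w]. So [phi] grows strictly less than linearly along a ray; the strictness later traps
    the scale of a perturbed point. *)
Lemma phi_scale_lt s w : w != 0 -> 1 < s -> phi (s * w) * w < s * (phi w * w).
Proof.
move=> w0 s1; have s0 : 0 < s := lt_trans ltr01 s1.
have y0 : phi w != 0 by rewrite phi_eq0.
have sg := phi_scale_sign s0 w0.
have y'0 : phi (s * w) != 0 by rewrite phi_eq0 mulf_neq0// gt_eqF.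
have lt1 : `|phi w| < `|phi (s * w)|.
  have h1 := phi_scale_gt w0 s1; have h2 := phiM_gt0 w0.
  move: w0; rewrite neq_lt => /orP[] w0.
    move: h1 h2; rewrite ltr_nM2r// nmulr_lgt0// => h1 h2.
    by rewrite !ltr0_norm// ?ltrN2// (lt_trans h1).
  move: h1 h2; rewrite ltr_pM2r// pmulr_lgt0// => h1 h2.
  by rewrite !gtr0_norm// (lt_trans h2).
have := quot_lt nf (_ : 0 < phi w * phi (s * w)); rewrite mulrC => /(_ sg lt1).
rewrite !phiK => h.
have : w / phi w * (phi (s * w) * phi w) < s * w / phi (s * w) * (phi (s * w) * phi w).
  by rewrite ltr_pM2r.
have -> : w / phi w * (phi (s * w) * phi w) = phi (s * w) * w by field.
by have -> : s * w / phi (s * w) * (phi (s * w) * phi w) = s * (phi w * w) by field.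
Qed.

Lemma phi_scale_le s w : 1 <= s -> phi (s * w) * w <= s * (phi w * w).
Proof.
rewrite le_eqVlt => /predU1P[<-|s1]; first by rewrite !mul1r.
have [->|w0] := eqVneq w 0; first by rewrite !mulr0.
exact/ltW/phi_scale_lt.
Qed.

(** By [prim_convex], the supremum over [t] of [t * w - prim f t] is attained at [t = phi w]. *)
Definition legendre w := phi w * w - prim f (phi w).

Lemma legendre_convex a b : legendre b - legendre a <= phi b * (b - a).
Proof.
have := prim_convex nf (phi a) (phi b); rewrite phiK /legendre; lra.
Qed.

Lemma legendre_ge0 w : 0 <= legendre w.
Proof.
have := energy_density_ge0 nf (phi w); have := phiM_ge0 w; rewrite /energy_density phiK /legendre; lra.
Qed.

Lemma legendre_le w : legendre w <= phi w * w.
Proof. by rewrite /legendre gerBl; exact: prim_ge0. Qed.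

(* Along a ray through [w], the dual energy of a point of the Nehari set is
   maximal at that point. *)
Lemma legendre_scale s w : 0 < s ->
  legendre (s * w) - legendre w <= (s ^+ 2 - 1) / 2 * (phi w * w).
Proof.
move=> s0; have [->|w0] := eqVneq w 0; first by rewrite !mulr0 subrr.
have y0 : phi w != 0 by rewrite phi_eq0.
have sg := phi_scale_sign s0 w0.
have := quot_star nf (y := phi w) (y' := phi (s * w)) y0.
rewrite mulrC => /(_ (ltW sg)); rewrite phiK /legendre => h.
have -> : phi w * w = w / phi w * phi w ^+ 2 by field.
have -> : phi (s * w) * (s * w) = w / phi w * (s * (phi (s * w) * phi w)) by field.
have q0 : 0 < w / phi w by have := quot_gt0 nf y0; rewrite phiK.
have := mulr_ge0 (ltW q0) (sqr_ge0 (phi (s * w) - s * phi w)).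
set q := w / phi w in h q0 *; lra.
Qed.

Definition dual_density w := energy_density f (phi w).

Lemma dual_densityE w : dual_density w = 2^-1 * (phi w * w) - prim f (phi w).
Proof. by rewrite /dual_density /energy_density phiK [w * _]mulrC. Qed.

Lemma dual_density_ge0 w : 0 <= dual_density w.
Proof. exact: energy_density_ge0. Qed.

Lemma dual_density_cont : continuous dual_density.
Proof.
move=> w; rewrite (_ : dual_density = fun w => 2^-1 * (phi w * w) - prim f (phi w)).
  apply: cvgB; last by apply: continuous_comp; [exact: phi_cont|exact: prim_cont].
  by apply: cvgM; [exact: cvg_cst|apply: cvgM; [exact: phi_cont|exact: cvg_id]].
by apply/funext => v; exact: dual_densityE.
Qed.

End Inverse.

(** * Ultralimits and nonpositive operators *)

Section Ultralimits.
Context {R : realType}.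

(** One ultrafilter finer than [\oo] makes every bounded real sequence converge, hence all sites at
    once and also the scales chosen later, without extracting subsequences. *)
Lemma ultrafilter_nat : exists2 U : set_system nat, UltraFilter U & \oo `<=` U.
Proof. by have [U [UU sU]] := @ultraFilterLemma nat \oo _; exists U. Qed.

Lemma ultra_bounded_cvg (U : set_system nat) (a : nat -> R) (C : R) :
  UltraFilter U -> (forall n, `|a n| <= C) ->
  exists2 l : R, `|l| <= C & a @ U --> l.
Proof.
move=> UU aC; have UP : ProperFilter U by exact: ultra_proper.
have cC := @segment_compact R (- C) C.
have [|l [lC cl]] := cC (a @ U) _.
  by apply: (@filterS _ U _ setT) => [n _ /=|]; [rewrite in_itv/= -ler_norml|exact: filterT].
exists l; first by move: lC; rewrite /= in_itv/= -ler_norml.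
move=> B Bl; have [//|nB] := in_ultra_setVsetC (a @^-1` B) UU.
have [x []] := cl (~` B) B nB Bl; by [].
Qed.

Lemma cvg_sum_seq (I T : Type) (F : set_system T) {FF : Filter F} (s : seq I)
    (h : T -> I -> R) (l : I -> R) :
  (forall i, h n i @[n --> F] --> l i) ->
  (\sum_(i <- s) h n i) @[n --> F] --> \sum_(i <- s) l i.
Proof.
move=> hl; elim: s => [|i s IH].
  by rewrite big_nil; under eq_fun do rewrite big_nil; exact: cvg_cst.
by rewrite big_cons; under eq_fun do rewrite big_cons; exact: cvgD.
Qed.

Context {N : nat}.

(** Finite partial sums pass to the limit along any proper filter, and [lsum_le_seq] bounds their
    supremum. *)
Lemma lsum_fatou (F : set_system nat) (FF : ProperFilter F)
    (h : nat -> lattice N -> R) (k : lattice N -> R) (c : nat -> R) (C : R) :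
  (forall n x, 0 <= h n x) -> (forall n, lsummable (h n)) ->
  (forall n, lsum (h n) <= c n) -> c @ F --> C ->
  (forall x, h n x @[n --> F] --> k x) -> lsummable k /\ lsum k <= C.
Proof.
move=> h0 hs hc cC hk; apply: lsum_le_seq.
  by move=> x; apply: (cvgr_to_ge (hk x)); apply: nearW => n; exact: h0.
move=> s us; have sc := @cvg_sum_seq _ _ F _ s h k hk.
apply: (ler_cvg_to (sc _) cC); apply: nearW => n.
exact: le_trans (ge0_le_seq_lsum _ _ us) (hc n).
Qed.

Lemma l2_ultralimit (U : set_system nat) (UU : UltraFilter U)
    (w : nat -> lattice N -> R) (C : R) :
  (forall n, l2 (w n)) -> (forall n, sqsum (w n) <= C) ->
  exists v, [/\ l2 v, sqsum v <= C & forall x, w n x @[n --> U] --> v x].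
Proof.
move=> ws wC; have UP : ProperFilter U by exact: ultra_proper.
have bd x : exists l : R, w n x @[n --> U] --> l.
  have [|l _ hl] := @ultra_bounded_cvg U (fun n => w n x) (Num.sqrt C) UU; last by exists l.
  move=> n; rewrite -sqrtr_sqr ler_wsqrtr//.
  exact: le_trans (le_sqsum x (ws n)) (wC n).
have [v hv] := choice bd; exists v.
have [] := @lsum_fatou U UP (fun n x => w n x ^+ 2) (fun x => v x ^+ 2) (fun=> C) C.
- by move=> n x; exact: sqr_ge0.
- exact: ws.
- exact: wC.
- exact: cvg_cst.
- by move=> x; rewrite expr2; under eq_fun do rewrite expr2; exact: cvgM.
by move=> v1 v2; split.
Qed.

End Ultralimits.

(** * Coercive resolvents, and directions in which the form is positive *)

Section NonpositiveOperator.
Context {R : realType} {N : nat}.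
Implicit Types u v w : lattice N -> R.
Local Notation L := (lattice N).

Lemma dot_le_weight c u v : 0 < c -> l2 u -> l2 v ->
  2 * dot u v <= c * sqsum u + c^-1 * sqsum v.
Proof.
move=> c0 us vs; have := @dot_le_sq _ _ (fun x => c * u x) v (l2Z c us) vs.
rewrite dotZl// sqsumZ// => h.
rewrite -(ler_pM2l c0) mulrDr mulrA [c * (c^-1 * _)]mulrA mulfV ?gt_eqF// mul1r.
lra.
Qed.

Lemma sqsum_eq0 u : l2 u -> sqsum u <= 0 -> u = fun=> 0.
Proof.
move=> us u0; apply/funext => x; apply/eqP; rewrite -sqrf_eq0 eq_le sqr_ge0 andbT.
exact: le_trans (le_sqsum x us) u0.
Qed.

Lemma neighbour_sum_lin c u v x :
  neighbour_sum (fun x => u x + c * v x) x = neighbour_sum u x + c * neighbour_sum v x.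
Proof. by rewrite /neighbour_sum mulr_sumr -big_split. Qed.

Lemma schrodinger_lin V c u v x :
  schrodinger V (fun x => u x + c * v x) x = schrodinger V u x + c * schrodinger V v x.
Proof. by rewrite !schrodingerE neighbour_sum_lin; ring. Qed.

(** The operator has finite range: its value at [x] involves finitely many sites. *)
Lemma schrodinger_cvg V (F : set_system nat) (FF : ProperFilter F)
    (w : nat -> L -> R) u x : (forall y, w n y @[n --> F] --> u y) ->
  schrodinger V (w n) x @[n --> F] --> schrodinger V u x.
Proof.
move=> wu; rewrite schrodingerE; under eq_fun do rewrite schrodingerE.
apply: cvgB; first by apply: cvgM; [exact: cvg_cst|exact: wu].
exact: cvg_sum_seq.
Qed.

Section Potential.
Variables (V : L -> R) (K : R).
Hypothesis VK : forall x, `|V x| <= K.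

Local Notation A := (schrodinger V).

Section Shifted.
Variable l : R.
Hypothesis l0 : 0 < l.
Hypothesis Anpos : forall u, l2 u -> dot (A u) u <= 0.

(** This is [l - A], coercive with constant [l] when [A] is nonpositive; its invertibility is a
    Lax-Milgram statement. *)
Let T u : L -> R := fun x => l * u x + -1 * A u x.

Let T_lin c u v x : T (fun x => u x + c * v x) x = T u x + c * T v x.
Proof. by rewrite /T schrodinger_lin; ring. Qed.

Let l2T u : l2 u -> l2 (T u).
Proof. by move=> us; apply: l2D; apply: l2Z => //; exact: (l2_schrodinger VK). Qed.

Let T_coercive u : l2 u -> l * sqsum u <= dot (T u) u.
Proof.
move=> us; have As := l2_schrodinger VK us.
rewrite dotDl//; [|exact: l2Z|exact: l2Z]; rewrite !dotZl// dotuu.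
by have := Anpos us; lra.
Qed.

Let T_bound : exists2 M, l ^+ 2 <= M & forall u, l2 u -> sqsum (T u) <= M * sqsum u.
Proof.
pose n : R := (size (@unit_steps N))%:R.
pose M0 := 2 * (K + n) ^+ 2 + 2 * n ^+ 2.
exists (2 * l ^+ 2 + 2 * M0).
  by rewrite /M0; have := sqr_ge0 (K + n); have := sqr_ge0 n; have := sqr_ge0 l; lra.
move=> u us; have As := l2_schrodinger VK us.
have := sqsum_schrodinger VK us; rewrite -/n -/M0 => hM.
have ls := l2Z l us; have ms := l2Z (-1) As.
rewrite sqsumD//; have := dot_le_sq ls ms.
by rewrite !sqsumZ// sqrrN expr1n mul1r; lra.
Qed.

Let T_inv_bound u v : l2 u -> l2 v -> (forall x, T u x = v x) ->
  sqsum u <= sqsum v / l ^+ 2.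
Proof.
move=> us vs Tu; have := T_coercive us.
have -> : dot (T u) u = dot v u by apply: eq_lsum => x; rewrite Tu.
have := dot_le_weight (c := l^-1) _ vs us; rewrite invr_gt0 => /(_ l0).
rewrite invrK => h1 h2; rewrite ler_pdivlMr ?exprn_gt0//.
have : l * sqsum u <= l^-1 * sqsum v by lra.
rewrite -(ler_pM2l l0) [l * (l^-1 * _)]mulrA mulfV ?gt_eqF// mul1r.
by rewrite expr2; lra.
Qed.

Let T_surj v : l2 v -> exists2 u, l2 u & forall x, T u x = v x.
Proof.
move=> vs; have [M lM TM] := T_bound.
have M0 : 0 < M := lt_le_trans (exprn_gt0 2 l0) lM.
(* [t] minimises [1 - 2 * t * l + t ^+ 2 * M], which bounds the ratio of successive squared
   residuals. The minimum is [rho], and [l ^+ 2 <= M] keeps it nonnegative. *)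
pose t := l / M; pose rho := 1 - l ^+ 2 / M.
have rho0 : 0 <= rho by rewrite subr_ge0 ler_pdivrMr// mul1r.
have rho1 : rho < 1 by rewrite /rho gtrBl divr_gt0// exprn_gt0.
(* Richardson iteration: the residuals tend to 0 and coercivity bounds the
   iterates, so an ultralimit of the iterates solves the equation. *)
pose step u x := u x + t * (v x - T u x).
pose it n := iter n step (fun=> 0).
pose r n x := v x - T (it n) x.
have its n : l2 (it n).
  elim: n => [|n IH]; first exact: l2_0.
  by rewrite /it iterS; apply: l2D => //; apply: l2Z; apply: l2B => //; exact: l2T.
have rs n : l2 (r n) by apply: l2B => //; exact: l2T.
have rS n x : r n.+1 x = r n x + - t * T (r n) x.
  rewrite /r /it iterS -/(it n) /step.
  have -> : T (fun x => it n x + t * (v x - T (it n) x)) x = T (it n) x + t * T (r n) x.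
    exact: T_lin.
  ring.
have rle n : sqsum (r n) <= rho ^+ n * sqsum v.
  elim: n => [|n IH].
    rewrite expr0 mul1r le_eqVlt; apply/predU1P; left; apply: eq_lsum => x.
    rewrite /r /it /= /T schrodingerE /neighbour_sum big1 ?mulr0 ?subr0 ?mulr0 ?addr0 ?subr0//.
  have Trs := l2T (rs n).
  have -> : sqsum (r n.+1) = sqsum (r n) + t ^+ 2 * sqsum (T (r n)) - 2 * t * dot (T (r n)) (r n).
    transitivity (sqsum (fun x => r n x + - t * T (r n) x)).
      by apply: eq_lsum => x; rewrite rS.
    rewrite sqsumD//; last exact: l2Z.
    rewrite sqsumZ// dotZr// [dot (r n) _]dotC; ring.
  have h1 := TM _ (rs n); have h2 := T_coercive (rs n).
  have t0 : 0 < t by rewrite divr_gt0.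
  rewrite [rho ^+ n.+1]exprS; apply: (@le_trans _ _ (rho * sqsum (r n)));
    last by rewrite -[leRHS]mulrA ler_wpM2l.
  have h3 : t ^+ 2 * sqsum (T (r n)) <= t ^+ 2 * (M * sqsum (r n)).
    by rewrite ler_wpM2l// sqr_ge0.
  have h4 : t * (l * sqsum (r n)) <= t * dot (T (r n)) (r n) by rewrite ler_pM2l.
  have E1 : t ^+ 2 * (M * sqsum (r n)) = l ^+ 2 / M * sqsum (r n).
    by rewrite /t; field; rewrite gt_eqF.
  have E2 : t * (l * sqsum (r n)) = l ^+ 2 / M * sqsum (r n).
    by rewrite /t; field; rewrite gt_eqF.
  rewrite E1 in h3; rewrite E2 in h4; rewrite /rho; lra.
have rle1 n : sqsum (r n) <= sqsum v.
  apply: le_trans (rle n) _; rewrite ler_piMl ?sqsum_ge0// exprn_ile1// ltW//.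
(* [T (it n)] is [v - r n], whose squared norm is at most 4 times that of [v]. *)
have itC n : sqsum (it n) <= 4 * sqsum v / l ^+ 2.
  have vrs : l2 (fun x => v x + -1 * r n x) by apply: l2D => //; exact: l2Z.
  have := T_inv_bound (its n) vrs; rewrite sqsumD//; last exact: l2Z.
  move=> h; apply: le_trans (h _) _; first by move=> x; rewrite /r; ring.
  rewrite ler_wpM2r ?invr_ge0 ?sqr_ge0//.
  have := dot_le_sq vs (l2Z (-1) (rs n)).
  by rewrite sqsumZ// sqrrN expr1n mul1r; have := rle1 n; lra.
have [U UU Uoo] := ultrafilter_nat.
have UP : ProperFilter U by exact: ultra_proper.
have [u [us _ hu]] := l2_ultralimit UU its itC.
exists u => // x.
have c1 : T (it n) x @[n --> U] --> T u x.
  apply: cvgD; first by apply: cvgM; [exact: cvg_cst|exact: hu].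
  by apply: cvgM; [exact: cvg_cst|exact: schrodinger_cvg].
have c2 : T (it n) x @[n --> U] --> v x.
  have rc : r n x @[n --> \oo] --> (0 : R).
    have g0 : (rho ^+ n * sqsum v) @[n --> \oo] --> (0 : R).
      rewrite -(mul0r (sqsum v)); apply: cvgM; last exact: cvg_cst.
      by apply: cvg_expr; rewrite ger0_norm.
    apply/cvgrPdist_lt => e e0; near=> n.
    rewrite sub0r normrN -ltr_sqr ?nnegrE ?(ltW e0)// real_normK ?num_real//.
    apply: le_lt_trans (le_sqsum x (rs n)) _; apply: le_lt_trans (rle n) _.
    apply: le_lt_trans (ler_norm _) _; rewrite -normrN -sub0r.
    by near: n; apply: cvgr_dist_lt g0 _ _; rewrite exprn_gt0.
  have -> : (fun n => T (it n) x) = (fun n => v x - r n x).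
    by apply/funext => n; rewrite /r; ring.
  rewrite -[X in _ --> X]subr0; apply: cvgB; first exact: cvg_cst.
  exact: cvg_trans (cvg_app _ Uoo) rc.
exact: (cvg_unique _ c1 c2).
Unshelve. all: by end_near. Qed.

(** [A - l] is [- T], so minus a chosen solution map of [T u = v] is a right inverse; injectivity of
    [T] makes it a left inverse too. *)
Lemma nonpos_resolvent : resolvent_set A l.
Proof.
have /choice[S hS] : forall v, exists u, l2 v -> l2 u /\ forall x, T u x = v x.
  move=> v; have [/T_surj[u us hu]|nv] := pselect (l2 v); first by exists u.
  by exists v => /nv.
have S1 v : l2 v -> l2 (fun x => -1 * S v x) by move=> /hS[? _]; exact: l2Z.
have Tinj u v : l2 u -> l2 v -> (forall x, T u x = T v x) -> u = v.
  move=> us vs E; have ds : l2 (fun x => u x + -1 * v x) by apply: l2D => //; exact: l2Z.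
  have := T_inv_bound ds l2_0; rewrite /sqsum.
  rewrite (_ : lsum (fun=> 0 ^+ 2) = 0) ?mul0r; last first.
    by rewrite -[RHS](@lsum0 R N); apply: eq_lsum => x; rewrite expr0n.
  move=> /(_ _)/(sqsum_eq0 ds) H; apply/funext => x; apply/eqP; rewrite -subr_eq0 -mulN1r.
  rewrite -[_ + _]/((fun x => u x + -1 * v x) x) H// => y.
  by rewrite T_lin E; ring.
exists (fun v x => -1 * S v x); split.
- by move=> v /ell2P vs; apply/ell2P; exact: S1.
- exists l^-1 => v /ell2P vs; have [Ss TS] := hS v vs.
  apply/ell2_norm_leP => //; [exact: S1|by rewrite invr_ge0 ltW|].
  rewrite sqsumZ// sqrrN expr1n mul1r.
  by apply: le_trans (T_inv_bound Ss vs TS) _; rewrite mulrC exprVn.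
- move=> v /ell2P vs; have [Ss TS] := hS v vs; apply/funext => x.
  have := schrodinger_lin V (-1) (fun=> 0) (S v) x.
  rewrite (_ : (fun x => 0 + _) = (fun x => -1 * S v x)); last first.
    by apply/funext => y; rewrite add0r.
  rewrite [X in _ = X + _](_ : _ = 0); last first.
    by rewrite schrodingerE /neighbour_sum big1 ?mulr0 ?subr0.
  rewrite /= => ->; rewrite -[RHS]TS /T /= /GRing.scale /=; ring.
- move=> u /ell2P us.
  have us' : l2 (A u \- l \*: u).
    by apply: l2B; [exact: (l2_schrodinger VK)|exact: l2Z].
  have [Ss TS] := hS _ us'.
  apply/Tinj => //; first exact: l2Z.
  move=> x; have := T_lin (-1) (fun=> 0) (S (A u \- l \*: u)) x.
  rewrite (_ : (fun x => 0 + _) = (fun x => -1 * S (A u \- l \*: u) x)); last first.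
    by apply/funext => y; rewrite add0r.
  rewrite [X in _ = X + _](_ : _ = 0); last first.
    by rewrite /T schrodingerE /neighbour_sum big1 ?mulr0 ?subr0 ?mulr0 ?addr0.
  by move=> ->; rewrite TS /T /= /GRing.scale /=; ring.
Qed.

End Shifted.

Lemma positive_direction l : 0 < l -> spectrum A l ->
  exists2 u, l2 u & 0 < dot (A u) u.
Proof.
move=> l0 sl; apply: contrapT => H; apply: sl; apply: nonpos_resolvent => // u us.
by rewrite leNgt; apply/negP => h; apply: H; exists u.
Qed.

(** Finite support matters because the pairing with [phi] need not be summable for a general element
    of [l2]. The form is continuous on [l2], so a close truncation keeps it positive. *)
Lemma positive_direction_finite l : 0 < l -> spectrum A l ->
  exists v, exists s : seq L, (forall x, x \notin s -> v x = 0) /\ 0 < dot (A v) v.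
Proof.
move=> l0 /(positive_direction l0)[u us D0]; apply: contrapT => H.
pose n : R := (size (@unit_steps N))%:R.
pose M := 2 * (K + n) ^+ 2 + 2 * n ^+ 2.
have M0 : 0 <= M by rewrite /M; have := sqr_ge0 (K + n); have := sqr_ge0 n; lra.
set D := dot (A u) u in D0.
have S0 := sqsum_ge0 u.
(* [c] weights Young's inequality so that the [A v] half of the cross term costs less than [D / 2];
   [k] collects the coefficients of [sqsum r], and the truncation error is taken below
   [D / (2 * k)]. *)
pose c := D / (2 * (M * sqsum u + 1)).
have Mu : 0 < M * sqsum u + 1 by rewrite ltr_wpDl// mulr_ge0.
have c0 : 0 < c by rewrite divr_gt0// mulr_gt0.
pose k := c^-1 + (M + 1) / 2.
have k0 : 0 < k by rewrite /k ltr_pwDl ?invr_gt0// divr_ge0// addr_ge0.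
have d0 : 0 < D / (2 * k) by rewrite divr_gt0// mulr_gt0.
have [v [s [vs v2 Sv]]] := l2_approx us d0.
set r := (fun x => u x - v x) => hr.
have rs : l2 r by exact: l2B.
have vneg : dot (A v) v <= 0.
  by rewrite leNgt; apply/negP => h; apply: H; exists v, s.
have As w : l2 w -> l2 (A w) by exact: (l2_schrodinger VK).
have uE : u = fun x => v x + 1 * r x by apply/funext => x; rewrite /r; ring.
clearbody r.
have E : D = dot (A v) v + 2 * dot (A v) r + dot (A r) r.
  have AE x : A u x = A v x + 1 * A r x by rewrite {1}uE schrodinger_lin.
  transitivity (dot (fun x => A v x + 1 * A r x) (fun x => v x + 1 * r x)).
    by apply: eq_lsum => x; rewrite -AE {2}uE.
  rewrite dotDl; try (by apply: l2Z; exact: As); try exact: As;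
    last by apply: l2D => //; exact: l2Z.
  rewrite !dotDr//; try exact: l2Z; try exact: As; last by apply: l2Z; exact: As.
  rewrite !(dotZr,dotZl)//; try exact: As; try exact: l2Z; try (by apply: l2Z; exact: As).
  rewrite (dot_schrodinger VK rs v2) [dot r _]dotC; ring.
have h1 := dot_le_weight c0 (As _ v2) rs.
have h2 := dot_le_sq (As _ rs) rs.
have h3 := sqsum_schrodinger VK v2; have h4 := sqsum_schrodinger VK rs.
rewrite -/n -/M in h3 h4.
have h5 : c * sqsum (A v) <= c * (M * sqsum u).
  by rewrite ler_pM2l// (le_trans h3)// ler_wpM2l.
have h6 : c * (M * sqsum u) < D / 2.
  have -> : D / 2 = c * (M * sqsum u + 1) by rewrite /c; field; rewrite gt_eqF.
  by rewrite ltr_pM2l// ltrDl.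
have h7 : k * sqsum r < D / 2.
  move: hr; rewrite ltr_pdivlMr ?mulr_gt0//; lra.
rewrite /k in h7; lra.
Qed.

End Potential.
End NonpositiveOperator.

(** * The inverse of the Schroedinger operator *)

Section InverseOperator.
Context {R : realType} {N : nat}.
Implicit Types u v w : lattice N -> R.
Local Notation L := (lattice N).

(** [inv_l] yields uniqueness of solutions in [l2], from which linearity of [B] and its commutation
    with periods are derived. *)
Record inverse_op (V : L -> R) (B : (L -> R) -> (L -> R)) : Prop := InverseOp {
  inv_l2 : forall v, l2 v -> l2 (B v);
  inv_bd : exists2 C, 0 <= C & forall v, l2 v -> sqsum (B v) <= C * sqsum v;
  inv_r : forall v x, l2 v -> schrodinger V (B v) x = v x;
  inv_l : forall u, l2 u -> B (schrodinger V u) = u }.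

Lemma resolvent_inverse_op V : ~ spectrum (schrodinger V) 0 ->
  exists B, inverse_op V B.
Proof.
move=> /contrapT[B [B1 [C BC] B2 B3]]; exists B.
have l2B v : l2 v -> l2 (B v) by move=> /ell2P/B1/ell2P.
have sub0 u : u \- 0 \*: u = u.
  by apply/funext => x; rewrite /= /GRing.scale /= mul0r subr0.
split=> //.
- exists (C ^+ 2); first exact: sqr_ge0.
  move=> v vs; have /ell2P/BC := vs; rewrite !ell2_norm_sqrt//; last exact: l2B.
  move=> h; have := sqsum_ge0 (B v); have := sqsum_ge0 v => h1 h2.
  rewrite -(sqr_sqrtr h1) -(sqr_sqrtr h2) -exprMn ler_sqr// nnegrE ?sqrtr_ge0//.
  exact: le_trans (sqrtr_ge0 _) h.
- move=> v x /ell2P/B2/(congr1 (fun g => g x)) /=.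
  by rewrite /GRing.scale /= mul0r subr0.
- by move=> u /ell2P/B3; rewrite (_ : _ \- _ = schrodinger V u)//; apply/funext => x;
    rewrite /= /GRing.scale /= mul0r subr0.
Qed.

Variables (V : L -> R) (K : R) (B : (L -> R) -> (L -> R)).
Hypothesis VK : forall x, `|V x| <= K.
Hypothesis BV : inverse_op V B.

Local Notation A := (schrodinger V).

Definition qform w : R := dot (B w) w.

Lemma inv_unique u v : l2 u -> (forall x, A u x = v x) -> B v = u.
Proof. by move=> us /funext <-; exact: (inv_l BV). Qed.

Lemma inv_lin c v w : l2 v -> l2 w ->
  B (fun x => v x + c * w x) = fun x => B v x + c * B w x.
Proof.
move=> vs ws; apply: inv_unique; last by move=> x; rewrite schrodinger_lin !(inv_r BV).
by apply: l2D; [|apply: l2Z]; exact: (inv_l2 BV).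
Qed.

Lemma schrodingerZ c u x : A (fun x => c * u x) x = c * A u x.
Proof. by rewrite !schrodingerE /neighbour_sum -mulr_sumr; ring. Qed.

Lemma inv_scale c v : l2 v -> B (fun x => c * v x) = fun x => c * B v x.
Proof.
move=> vs; apply: inv_unique; first by apply: l2Z; exact: (inv_l2 BV).
by move=> x; rewrite schrodingerZ (inv_r BV).
Qed.

Lemma inv_sym v w : l2 v -> l2 w -> dot (B v) w = dot v (B w).
Proof.
move=> vs ws; have Bv := inv_l2 BV vs; have Bw := inv_l2 BV ws.
transitivity (dot (B v) (A (B w))).
  by apply: eq_lsum => x; rewrite (inv_r BV).
rewrite -(dot_schrodinger VK Bv Bw).
by apply: eq_lsum => x; rewrite (inv_r BV).
Qed.

Lemma inv_shift a v : (forall x, V (x + a) = V x) -> l2 v ->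
  B (fun x => v (x + a)) = fun x => B v (x + a).
Proof.
move=> Va vs; apply: inv_unique; first by apply: l2_shift; exact: (inv_l2 BV).
move=> x; rewrite -[RHS](inv_r BV)// !schrodingerE Va; congr (_ - _).
by apply: eq_bigr => d _; rewrite addrAC.
Qed.

Lemma qform_bound : exists2 C, 0 < C & forall w, l2 w -> qform w <= C * sqsum w.
Proof.
have [C C0 BC] := inv_bd BV; exists (C + 1); first by rewrite ltr_wpDl.
move=> w ws; have := dot_le_sq (inv_l2 BV ws) ws; have := BC _ ws.
have := sqsum_ge0 w; have := mulr_ge0 C0 (sqsum_ge0 w); rewrite -/(qform w); lra.
Qed.

Lemma qform_scale c w : l2 w -> qform (fun x => c * w x) = c ^+ 2 * qform w.
Proof.
move=> ws; have Bw := inv_l2 BV ws.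
rewrite /qform inv_scale// dotZl//; last exact: l2Z.
by rewrite dotZr//; ring.
Qed.

Lemma qform_site w e a : l2 w -> qform (fun x => w x + e * site a x) =
  qform w + 2 * e * B w a + e ^+ 2 * B (site a) a.
Proof.
move=> ws; have ss := l2_site a : l2 (site a : L -> R).
have Bw := inv_l2 BV ws; have Bs := inv_l2 BV ss.
have es := l2Z e ss; have eBs := l2Z e Bs.
rewrite /qform inv_lin// dotDl//; last exact: l2D.
rewrite !dotDr// !(dotZl, dotZr)// -(dot_site a Bw) -(dot_site a Bs).
by rewrite (inv_sym ss ws) [dot (site a) (B w)]dotC; ring.
Qed.

Lemma qform_shift a w : (forall x, V (x + a) = V x) -> l2 w ->
  qform (fun x => w (x + a)) = qform w.
Proof.
move=> Va ws; rewrite /qform inv_shift// /dot.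
exact: (@lsum_shift _ _ a (fun x => B w x * w x) (l2M (inv_l2 BV ws) ws)).
Qed.

(** If [v] has finite support, [A v] is supported within one step of it, and [qform B (A v)] equals
    [dot v (A v)]. *)
Lemma qform_pos_finite l : 0 < l -> spectrum A l ->
  exists z, exists s : seq L, (forall x, x \notin s -> z x = 0) /\ 0 < qform z.
Proof.
move=> l0 /(positive_direction_finite VK l0)[v [s [vs v0]]].
have v2 := l2_finite vs.
exists (A v), (s ++ [seq y - d | y <- s, d <- @unit_steps N]); split.
  move=> x; rewrite mem_cat negb_or => /andP[xs xd].
  rewrite schrodingerE vs// mulr0 sub0r /neighbour_sum big1_seq ?oppr0// => d /andP[_ dn].
  apply: vs; apply: contra xd => xds; apply/allpairsP; exists (x + d, d).
  by split=> //=; rewrite addrK.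
by rewrite /qform (inv_l BV v2) dotC.
Qed.

End InverseOperator.

(** * The dual Nehari set *)

Section Nehari.
Context {R : realType} {N : nat}.
Implicit Types u v w : lattice N -> R.
Local Notation L := (lattice N).

Variables (V : L -> R) (K : R) (B : (L -> R) -> (L -> R)) (f : L -> R -> R).
Hypothesis VK : forall x, `|V x| <= K.
Hypothesis BV : inverse_op V B.
Hypothesis nf : forall x, nonlinearity (f x).
Hypothesis sf : forall x (M : R), exists K : R, forall t,
  K < `|t| -> M < prim (f x) t / t ^+ 2.

Local Notation Q := (qform B).

Definition pairing w (x : L) : R := phi (f x) (w x) * w x.
Definition dual_class w : Prop := l2 w /\ lsummable (pairing w).
(** Agrees with J on the Nehari set, by [nehari_energy]; being a sum of nonnegative densities, it is
    open to Fatou. *)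
Definition dual_energy w : R := lsum (fun x => dual_density (f x) (w x)).

Record nehari w : Prop := NehariPoint {
  nehari_l2 : l2 w;
  nehari_pairing : lsummable (pairing w);
  nehari_neq0 : exists x, w x != 0;
  nehari_eq : lsum (pairing w) = Q w }.

Lemma pairing_ge0 w x : 0 <= pairing w x.
Proof. exact: (phiM_ge0 (nf x) (sf x)). Qed.

Lemma dual_density_le_pairing w x : dual_density (f x) (w x) <= 2^-1 * pairing w x.
Proof.
by rewrite (dual_densityE (nf x) (sf x)) gerBl; exact: prim_ge0.
Qed.

Lemma lsummable_dual_density w : lsummable (pairing w) ->
  lsummable (fun x => dual_density (f x) (w x)).
Proof.
move=> ws; apply: ge0_le_lsummable (lsummableZ 2^-1 ws) => x.
by rewrite dual_density_ge0//= dual_density_le_pairing.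
Qed.

Lemma lsummable_legendre w : lsummable (pairing w) ->
  lsummable (fun x => legendre (f x) (w x)).
Proof.
move=> ws; apply: ge0_le_lsummable ws => x.
by rewrite (legendre_ge0 (nf x) (sf x)) legendre_le.
Qed.

Lemma dual_energyE w : lsummable (pairing w) ->
  dual_energy w = lsum (fun x => legendre (f x) (w x)) - 2^-1 * lsum (pairing w).
Proof.
move=> ws; rewrite -lsumZ// -lsumB; [|exact: lsummable_legendre|exact: lsummableZ].
apply: eq_lsum => x; rewrite (dual_densityE (nf x) (sf x)) /legendre /pairing; lra.
Qed.

(** The formal derivative in [s] of the Legendre sum along the ray through [w]; the Nehari equation
    for [s * w] reads [ray w s = s * Q w]. *)
Definition ray w s : R := lsum (fun x => phi (f x) (s * w x) * w x).

Lemma phi_scale_shrink x s w : 0 < s -> s <= 1 ->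
  phi (f x) (s * w x) * w x <= pairing w x.
Proof.
move=> s0 s1; have := phi_scale_ge (nf x) (sf x) (s := s^-1) (s * w x).
rewrite invf_ge1// => /(_ s1); rewrite mulKf ?gt_eqF//.
by rewrite !(mulrCA _ s) ler_pM2l.
Qed.

Lemma ray_ge0 x s w : 0 < s -> 0 <= phi (f x) (s * w x) * w x.
Proof.
by move=> s0; have := phiM_ge0 (nf x) (sf x) (s * w x); rewrite mulrCA pmulr_rge0.
Qed.

Lemma lsum_ray_ge0 w s : 0 < s -> 0 <= ray w s.
Proof. by move=> s0; apply: lsum_ge0 => x; exact: ray_ge0. Qed.

Lemma lsummable_ray w s : 0 < s -> lsummable (pairing w) ->
  lsummable (fun x => phi (f x) (s * w x) * w x).
Proof.
move=> s0 ws; have [s1|/ltW s1] := leP s 1.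
  by apply: ge0_le_lsummable ws => x; rewrite ray_ge0//= phi_scale_shrink.
apply: ge0_le_lsummable (lsummableZ s ws) => x.
by rewrite ray_ge0//=; exact: (phi_scale_le (nf x) (sf x)).
Qed.

Lemma pairing_scale w s x :
  pairing (fun x => s * w x) x = s * (phi (f x) (s * w x) * w x).
Proof. by rewrite /pairing mulrCA. Qed.

Lemma lsummable_pairing_scale w s : 0 < s -> lsummable (pairing w) ->
  lsummable (pairing (fun x => s * w x)).
Proof.
move=> s0 ws; apply: eq_lsummable (lsummableZ s (lsummable_ray s0 ws)) => x.
by rewrite pairing_scale.
Qed.

Lemma lsum_pairing_scale w s : 0 < s -> lsummable (pairing w) ->
  lsum (pairing (fun x => s * w x)) = s * ray w s.
Proof.
move=> s0 ws; rewrite -lsumZ; last exact: lsummable_ray.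
by apply: eq_lsum => x; rewrite pairing_scale.
Qed.

(** Along a ray the sum does not decrease while its quotient by [s] does not increase. The two
    together give continuity on [s > 0] with an explicit modulus. *)
Lemma ray_bounds w s t : lsummable (pairing w) -> 0 < s -> s <= t ->
  0 <= ray w t - ray w s <= (t / s - 1) * ray w s.
Proof.
move=> ws s0 st; have t0 := lt_le_trans s0 st.
have rs := lsummable_ray s0 ws; have rt := lsummable_ray t0 ws.
have ts1 : 1 <= t / s by rewrite ler_pdivlMr// mul1r.
have tE x : t / s * (s * w x) = t * w x by field; rewrite gt_eqF.
have h1 : ray w s <= ray w t.
  apply: le_lsum => // x; rewrite -(ler_pM2l s0) -tE.
  rewrite mulrCA [s * (phi _ _ * _)]mulrCA.
  by have := phi_scale_ge (nf x) (sf x) (s * w x) ts1.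
have h2 : ray w t <= t / s * ray w s.
  rewrite -lsumZ//; apply: le_lsum => //; first exact: lsummableZ.
  move=> x; rewrite -(ler_pM2l s0) -[in leLHS]tE.
  have := phi_scale_le (nf x) (sf x) (s * w x) ts1.
  set p := phi _ (t / s * _); set r := phi _ (s * _) => h.
  have -> : s * (p * w x) = p * (s * w x) by ring.
  by have -> : s * (t / s * (r * w x)) = t / s * (r * (s * w x)) by ring.
by apply/andP; split; lra.
Qed.

Lemma ray_continuous w s : lsummable (pairing w) -> 0 < s -> {for s, continuous (ray w)}.
Proof.
move=> ws s0; apply/cvgrPdist_le => e e0.
pose c := ray w (s + 1) + 1.
have c0 : 0 < c.
  by rewrite /c ltr_wpDl// lsum_ray_ge0// addr_gt0.
(* The three bounds keep [t] away from 0, keep it below [s + 1] where the ray sum is at most [c],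
   and make the increment at most [e]. *)
have dd : 0 < Num.min (s / 2) (Num.min 1 (e * s / (2 * c))).
  by rewrite !lt_min ltr01 !divr_gt0 ?mulr_gt0.
near=> t.
have : `|s - t| < Num.min (s / 2) (Num.min 1 (e * s / (2 * c))).
  by near: t; exact: cvgr_dist_lt.
rewrite !lt_min => /and3P[h1 h2 h3].
have [t1 t2] : s / 2 < t /\ t < s + 1.
  by move: h1 h2; rewrite !ltr_distl => /andP[? ?] /andP[? ?]; split; lra.
have t0 : 0 < t by apply: lt_trans t1; rewrite divr_gt0.
have rc r : 0 < r -> r <= s + 1 -> 0 <= ray w r <= c.
  move=> r0 rs; have /andP[h _] := ray_bounds ws r0 rs.
  by rewrite /c lsum_ray_ge0//=; lra.
have key a b : 0 < a -> a <= b -> b <= s + 1 -> s / 2 <= a ->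
    b - a < e * s / (2 * c) -> 0 <= ray w b - ray w a <= e.
  move=> a0 ab bs sa hba; have /andP[k1 k2] := ray_bounds ws a0 ab.
  have /andP[r1 r2] := rc a a0 (le_trans ab bs).
  rewrite k1 (le_trans k2)//.
  have -> : (b / a - 1) * ray w a = (b - a) * ray w a / a by field; rewrite gt_eqF.
  rewrite ler_pdivrMr//.
  have : (b - a) * ray w a <= e * s / (2 * c) * c.
    by apply: ler_pM => //; [rewrite subr_ge0|exact: ltW].
  have -> : e * s / (2 * c) * c = e * (s / 2) by field; rewrite gt_eqF.
  by move=> /le_trans; apply; rewrite ler_pM2l.
have [st|ts] := leP s t.
  have h3' : t - s < e * s / (2 * c) by move: h3; rewrite distrC ger0_norm// subr_ge0.
  have s2 : s / 2 <= s by lra.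
  have /andP[k1 k2] := key s t s0 st (ltW t2) s2 h3'.
  by rewrite distrC ger0_norm.
have s1 : s <= s + 1 by rewrite lerDl.
have h3' : s - t < e * s / (2 * c) by move: h3; rewrite ger0_norm// subr_ge0 ltW.
have /andP[k1 k2] := key t s t0 (ltW ts) s1 (ltW t1) h3'.
by rewrite ger0_norm.
Unshelve. all: by end_near. Qed.

Lemma nehari_on_ray w s0 s1 : dual_class w -> (exists x, w x != 0) ->
  0 < s0 -> s0 <= s1 -> s0 * Q w <= ray w s0 -> ray w s1 <= s1 * Q w ->
  exists2 s, s0 <= s <= s1 & nehari (fun x => s * w x).
Proof.
move=> [ws wp] [x0 wx0] s00 s01 h0 h1.
pose h s := ray w s - s * Q w.
have hc : {within `[s0, s1], continuous h}.
  apply: continuous_in_subspaceT => s; rewrite inE/= in_itv/= => /andP[ss _].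
  have sp : 0 < s := lt_le_trans s00 ss.
  apply: cvgB; first exact: ray_continuous.
  by apply: cvgM; [exact: cvg_id|exact: cvg_cst].
have [|s] := IVT s01 hc (v := 0).
  by rewrite ge_min le_max /h !subr_le0 !subr_ge0 h1 h0 orbT.
rewrite in_itv/= => ss hs; exists s => //.
have sp : 0 < s by move: ss => /andP[+ _]; exact: lt_le_trans.
split.
- exact: l2Z.
- exact: lsummable_pairing_scale.
- by exists x0; rewrite mulf_neq0// gt_eqF.
- rewrite lsum_pairing_scale// (qform_scale BV)//.
  by move/eqP: hs; rewrite /h subr_eq0 => /eqP ->; rewrite mulrA expr2.
Qed.

Lemma nehari_energy w : nehari w ->
  dual_energy w = lsum (fun x => legendre (f x) (w x)) - 2^-1 * Q w.
Proof. by move=> nw; rewrite dual_energyE ?(nehari_eq nw)//; exact: nehari_pairing. Qed.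

Lemma lsum_legendre_scale w s : 0 < s -> lsummable (pairing w) ->
  lsum (fun x => legendre (f x) (s * w x)) <=
  lsum (fun x => legendre (f x) (w x)) + (s ^+ 2 - 1) / 2 * lsum (pairing w).
Proof.
move=> s0 ws; have c1 := lsummable_legendre ws.
have c2 := lsummable_legendre (lsummable_pairing_scale s0 ws).
rewrite -lsumZ// -lsumD//; last exact: lsummableZ.
apply: le_lsum => //; first by apply: lsummableD => //; exact: lsummableZ.
by move=> x; have := legendre_scale (nf x) (sf x) (w x) s0; rewrite /pairing; lra.
Qed.

Lemma site_change w e a x : x != a -> w x + e * site a x = w x.
Proof. by move=> /negPf xa; rewrite /site xa mulr0 addr0. Qed.

Lemma site_same w e a : w a + e * site a a = w a + e.
Proof. by rewrite /site eqxx mulr1. Qed.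

Lemma dual_class_site w e a : dual_class w -> dual_class (fun x => w x + e * site a x).
Proof.
move=> [ws wp]; split; first by apply: l2D => //; apply: l2Z; exact: l2_site.
by have [] := @lsum_change _ _ a (pairing w) (pairing (fun x => w x + e * site a x));
  first by move=> x xa; rewrite /pairing site_change.
Qed.

(** [legendre_scale] bounds the growth of the Legendre sum by a multiple of [Q w], which cancels
    exactly against the change of the quadratic part. The sites other than [a] thus cost nothing,
    however far [s] is from 1. *)
Lemma nehari_perturb w e a s : nehari w -> 0 < s ->
  nehari (fun x => s * (w x + e * site a x)) ->
  dual_energy (fun x => s * (w x + e * site a x)) <= dual_energy w +
    s * (e * phi (f a) (s * (w a + e))) - s ^+ 2 * (e * B w a + e ^+ 2 / 2 * B (site a) a).
Proof.
move=> nw s0 nz; rewrite (nehari_energy nz) (nehari_energy nw).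
have [ws wp] := (nehari_l2 nw, nehari_pairing nw).
have [zs zp] : dual_class (fun x => w x + e * site a x) by exact: dual_class_site.
rewrite (qform_scale BV)// (qform_site VK BV)//.
have cw := lsum_legendre_scale s0 wp; rewrite (nehari_eq nw) in cw.
have [_ ->] := @lsum_change _ _ a (fun x => legendre (f x) (s * w x))
  (fun x => legendre (f x) (s * (w x + e * site a x)))
  (fun x xa => congr1 (fun z => legendre (f x) (s * z)) (site_change w e xa))
  (lsummable_legendre (lsummable_pairing_scale s0 wp)).
rewrite site_same.
have := legendre_convex (nf a) (sf a) (s * w a) (s * (w a + e)).
have -> : s * (w a + e) - s * w a = s * e by ring.
move: cw; move: (lsum _) (lsum _) (Q w) (legendre _ _) (legendre _ _) (phi _ _) (B _ _) (B _ _).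
move=> C1 C2 q cb ca p b k h1 h2.
rewrite -subr_ge0 in h1; rewrite -subr_ge0 in h2; rewrite -subr_ge0.
by apply: le_trans (addr_ge0 h1 h2) _; rewrite le_eqVlt; apply/predU1P; left; field.
Qed.

Lemma ray_site w e a s : 0 < s -> dual_class w ->
  ray (fun x => w x + e * site a x) s = ray w s +
  (phi (f a) (s * (w a + e)) * (w a + e) - phi (f a) (s * w a) * w a).
Proof.
move=> s0 [ws wp].
have [|_] := @lsum_change _ _ a (fun x => phi (f x) (s * w x) * w x)
  (fun x => phi (f x) (s * (w x + e * site a x)) * (w x + e * site a x)) _ (lsummable_ray s0 wp).
  by move=> x xa; rewrite site_change.
by rewrite site_same.
Qed.

(** All terms of the difference have one sign by sublinearity of [phi], so a single term bounds the
    sum. The site [x] can stay fixed while [w] runs along a sequence. *)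
Lemma ray_above w s x : lsummable (pairing w) -> 1 <= s ->
  ray w s - s * lsum (pairing w) <=
  phi (f x) (s * w x) * w x - s * (phi (f x) (w x) * w x).
Proof.
move=> ws s1; have s0 : 0 < s := lt_le_trans ltr01 s1.
have rs := lsummable_ray s0 ws; have ss := lsummableZ s ws.
rewrite -lerN2 !opprB -lsumZ// -lsumB//.
apply: (@ge0_le_lsum _ _ (fun x => s * pairing w x - phi (f x) (s * w x) * w x)).
  by move=> y; rewrite subr_ge0; exact: (phi_scale_le (nf y) (sf y) (w y)).
exact: lsummableB.
Qed.

Lemma ray_below w s x : lsummable (pairing w) -> 0 < s -> s <= 1 ->
  phi (f x) (s * w x) * w x - s * (phi (f x) (w x) * w x) <=
  ray w s - s * lsum (pairing w).
Proof.
move=> ws s0 s1.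
have rs := lsummable_ray s0 ws; have ss := lsummableZ s ws.
rewrite -lsumZ// -lsumB//.
apply: (@ge0_le_lsum _ _ (fun x => phi (f x) (s * w x) * w x - s * pairing w x)).
  move=> y; rewrite subr_ge0.
  have := phi_scale_le (nf y) (sf y) (s := s^-1) (s * w y).
  rewrite invf_ge1// => /(_ s1); rewrite mulKf ?gt_eqF// => h.
  move: h; rewrite /pairing; set p := phi _ (w y); set r := phi _ (s * _).
  have -> : p * (s * w y) = s * (p * w y) by ring.
  by have -> : s^-1 * (r * (s * w y)) = r * w y by field; rewrite gt_eqF.
exact: lsummableB.
Qed.

Lemma nehari_of_solution u : l2 u -> (exists x, u x != 0) ->
  (forall x, schrodinger V u x = f x (u x)) ->
  nehari (fun x => f x (u x)) /\ B (fun x => f x (u x)) = u.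
Proof.
move=> us [x0 ux0] eqn.
have Bu : B (fun x => f x (u x)) = u by exact: (inv_unique BV us).
have fs : l2 (fun x => f x (u x)) by apply: eq_l2 (l2_schrodinger VK us).
have ps x : pairing (fun x => f x (u x)) x = u x * f x (u x).
  by rewrite /pairing (nlK (nf x) (sf x)).
split=> //; split => //.
- by apply: eq_lsummable (l2M us fs) => x; rewrite ps.
- exists x0; apply: contra_neq ux0 => h.
  by apply: (nl_inj (nf x0)); rewrite (nl0 (nf x0)).
- by rewrite /qform Bu; apply: eq_lsum => x; rewrite ps.
Qed.

End Nehari.

(** * Bounds on the Nehari set, uniform by periodicity *)

Section PeriodicNehari.
Context {R : realType} {N : nat}.
Implicit Types u v w : lattice N -> R.
Local Notation L := (lattice N).

Variables (V : L -> R) (K : R) (B : (L -> R) -> (L -> R)) (f : L -> R -> R).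
Hypothesis VK : forall x, `|V x| <= K.
Hypothesis BV : inverse_op V B.
Hypothesis nf : forall x, nonlinearity (f x).
Hypothesis f0u : forall e : R, 0 < e -> exists2 d : R, 0 < d &
  forall x t, `|t| < d -> `|f x t| <= e * `|t|.
Hypothesis fb : forall k : R, exists k', forall x t, `|t| <= k -> `|f x t| <= k'.
Hypothesis sfu : forall M : R, exists K : R, forall x t,
  K < `|t| -> M < prim (f x) t / t ^+ 2.

Variables (G : set L) (cell : seq L).
Hypothesis VG : forall a x, G a -> V (x + a) = V x.
Hypothesis fG : forall a x, G a -> f (x + a) = f x.
Hypothesis cellG : forall x, exists2 a, G a & x - a \in cell.

Lemma superquadratic_at x (M : R) : exists K : R, forall t,
  K < `|t| -> M < prim (f x) t / t ^+ 2.
Proof. by have [k hk] := sfu M; exists k => t; exact: hk. Qed.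

Local Notation sf := superquadratic_at.
Local Notation Q := (qform B).
Local Notation nehari := (nehari B f).
Local Notation I := (dual_energy f).
Local Notation P := (pairing f).

Lemma periodic_lower_bound (g : L -> R) : (forall x, 0 < g x) ->
  (forall a x, G a -> g (x + a) = g x) -> exists2 c, 0 < c & forall x, c <= g x.
Proof.
move=> g0 gG; have [c c0 hc] : exists2 c, 0 < c & forall x, x \in cell -> c <= g x.
  elim: cell => [|y s [c c0 hc]]; first by exists 1.
  exists (Num.min c (g y)); first by rewrite lt_min c0 g0.
  move=> x; rewrite inE => /predU1P[->|/hc xc]; first by rewrite ge_min lexx orbT.
  by rewrite ge_min xc.
exists c => // x; have [a Ga xa] := cellG x.
by rewrite -(subrK a x) gG// hc.
Qed.

Lemma energy_density_coercive C :
  exists k, forall x t, energy_density (f x) t <= C -> `|t| <= k.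
Proof.
(* The threshold makes [f t / t] exceed [2 * C + k1], while the quotient is at most [k1] at the unit
   vector [s] on the same side; comparing densities at [t] and [s] contradicts the bound [C]. *)
have [k1 hk1] := fb 1; have [k2 hk2] := sfu (2^-1 * (2 * C + k1)).
exists (Num.max k2 1) => x t tC; rewrite le_max -implyNb -ltNge; apply/implyP => kt.
rewrite leNgt; apply/negP => t1.
have t0 : t != 0 by rewrite -normr_gt0 (lt_trans ltr01).
pose s := t / `|t|.
have ns : `|s| = 1 by rewrite normrM normfV normr_id divff// normr_eq0.
have st : 0 < s * t.
  have -> : s * t = t ^+ 2 / `|t| by rewrite /s; ring.
  by rewrite divr_gt0 ?normr_gt0// exprn_even_gt0.
have ss : s ^+ 2 = 1 by rewrite -real_normK ?num_real// ns expr1n.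
have := energy_density_quot (nf x) st; rewrite ns => /(_ (ltW t1)); rewrite ss mulr1.
have := energy_density_ge0 (nf x) s; have := quot_gt_prim (nf x) t0 (hk2 x t kt).
have : f x s / s <= k1.
  apply: le_trans (ler_norm _) _; rewrite normrM normfV ns invr1 mulr1.
  by apply: hk1; rewrite ns.
lra.
Qed.

(** The density grows with [|t|] on each half-line, so its values at [d] and [- d] decide, and these
    are periodic in [x]. *)
Lemma energy_density_bounded_below d : 0 < d ->
  exists2 c, 0 < c & forall x t, d <= `|t| -> c <= energy_density (f x) t.
Proof.
move=> d0; have dn0 : d != 0 by rewrite gt_eqF.
have nd0 : - d != 0 by rewrite oppr_eq0.
have [c1 c10 h1] := @periodic_lower_bound (fun x => energy_density (f x) d)
  (fun x => energy_density_gt0 (nf x) dn0)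
  (fun a x Ga => congr1 (fun h => energy_density h d) (fG x Ga)).
have [c2 c20 h2] := @periodic_lower_bound (fun x => energy_density (f x) (- d))
  (fun x => energy_density_gt0 (nf x) nd0)
  (fun a x Ga => congr1 (fun h => energy_density h (- d)) (fG x Ga)).
exists (Num.min c1 c2); first by rewrite lt_min c10.
move=> x t dt; have [t0|t0|t0] := ltgtP t 0.
- rewrite ge_min (le_trans (h2 x)) ?orbT//; apply: (energy_density_le (nf x)).
    by rewrite mulNr oppr_gt0 pmulr_rlt0.
  by rewrite normrN gtr0_norm.
- rewrite ge_min (le_trans (h1 x))//; apply: (energy_density_le (nf x)); first exact: mulr_gt0.
  by rewrite [`|d|]gtr0_norm.
- by move: dt; rewrite t0 normr0 leNgt d0.
Qed.

(** [e] is such that [e * Q w] is at most half of [sqsum w]. Where [phi] is small, squares are at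
    most [e] times the pairing, and on the Nehari set the pairing sums to [Q w]. *)
Lemma small_quotient : exists2 d, 0 < d & exists2 e, 0 < e &
  (forall w, l2 w -> e * Q w <= 2^-1 * sqsum w) /\
  (forall w x, `|phi (f x) (w x)| < d -> w x ^+ 2 <= e * P w x).
Proof.
have [C C0 hC] := qform_bound BV.
have e0 : 0 < (2 * C)^-1 by rewrite invr_gt0 mulr_gt0.
have [d d0 hd] := f0u e0; exists d => //; exists (2 * C)^-1 => //; split.
  move=> w /hC h; rewrite -(ler_pM2l C0).
  have -> : C * ((2 * C)^-1 * Q w) = 2^-1 * Q w by field; rewrite gt_eqF.
  lra.
move=> w x /(hd x); rewrite (phiK (nf x) (sf x)) => h.
have p0 := phiM_ge0 (nf x) (sf x) (w x).
rewrite -[w x ^+ 2]real_normK ?num_real// expr2 /pairing -(ger0_norm p0) normrM mulrA.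
by rewrite ler_wpM2r.
Qed.

(** Sites with small [phi] are absorbed by [small_quotient]. At the others the density is at least
    [c] and [|w x| <= k'], so a multiple of the density pays for the square. *)
Lemma nehari_l2_bound C : exists C', forall w, nehari w -> I w <= C -> sqsum w <= C'.
Proof.
have [d d0 [e e0 [eQ hd]]] := small_quotient.
have [c c0 hc] := energy_density_bounded_below d0.
have [k hk] := energy_density_coercive C; have [k' hk'] := fb k.
exists (2 * (k' ^+ 2 / c * C)) => w nw wC.
have [ws wp] := (nehari_l2 nw, nehari_pairing nw).
have gs := lsummable_dual_density nf sf wp.
have : sqsum w <= e * Q w + k' ^+ 2 / c * I w.
  rewrite -(nehari_eq nw) -!lsumZ// -lsumD; [|exact: lsummableZ|exact: lsummableZ].
  apply: le_lsum => //; first by apply: lsummableD; exact: lsummableZ.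
  move=> x; have kc : 0 <= k' ^+ 2 / c by rewrite divr_ge0 ?sqr_ge0// ltW.
  have g0 := dual_density_ge0 (nf x) (w x); have p0 := pairing_ge0 nf sf w x.
  have [wd|wd] := ltP `|phi (f x) (w x)| d.
    by have := hd _ _ wd; have := mulr_ge0 kc g0; lra.
  have gC : dual_density (f x) (w x) <= C.
    apply: le_trans wC.
    by apply: (@ge0_le_lsum _ _ (fun y => dual_density (f y) (w y))) => // y;
      exact: dual_density_ge0.
  have wk : `|w x| <= k'.
    by rewrite -(phiK (nf x) (sf x) (w x)); apply: hk'; apply: hk gC.
  have : w x ^+ 2 <= k' ^+ 2.
    rewrite -[w x ^+ 2]real_normK ?num_real//.
    by rewrite ler_sqr ?nnegrE// (le_trans _ wk).
  have : k' ^+ 2 / c * c <= k' ^+ 2 / c * dual_density (f x) (w x) by rewrite ler_wpM2l// hc.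
  by rewrite divfK ?gt_eqF//; have := mulr_ge0 (ltW e0) p0; lra.
have kc : 0 <= k' ^+ 2 / c by rewrite divr_ge0 ?sqr_ge0// ltW.
have : k' ^+ 2 / c * I w <= k' ^+ 2 / c * C by rewrite ler_wpM2l.
by have := eQ w ws; lra.
Qed.

Lemma nehari_nonvanishing : exists2 d, 0 < d &
  forall w, nehari w -> exists x, d <= `|phi (f x) (w x)|.
Proof.
have [d d0 [e e0 [eQ hd]]] := small_quotient; exists d => // w nw.
apply: contrapT => H; have [ws wp] := (nehari_l2 nw, nehari_pairing nw).
have h : sqsum w <= e * Q w.
  rewrite -(nehari_eq nw) -lsumZ//; apply: le_lsum => //; first exact: lsummableZ.
  by move=> x; apply: hd; rewrite ltNge; apply/negP => dx; apply: H; exists x.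
have w0 : sqsum w <= 0 by have := eQ w ws; lra.
have [x] := nehari_neq0 nw.
by rewrite (sqsum_eq0 ws w0) eqxx.
Qed.

Lemma pairing_shift a w x : G a -> P (fun z => w (z + a)) x = P w (x + a).
Proof. by move=> Ga; rewrite /pairing fG. Qed.

Lemma nehari_shift a w : G a -> nehari w ->
  nehari (fun x => w (x + a)) /\ I (fun x => w (x + a)) = I w.
Proof.
move=> Ga nw; have [ws wp] := (nehari_l2 nw, nehari_pairing nw).
have gs := lsummable_dual_density nf sf wp.
split; last first.
  rewrite -[RHS](@lsum_shift _ _ a _ gs).
  by apply: eq_lsum => x; rewrite fG.
split.
- exact: l2_shift.
- by apply: eq_lsummable (lsummable_shift a wp) => x; rewrite pairing_shift.
- have [x wx] := nehari_neq0 nw; exists (x - a); by rewrite subrK.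
- rewrite (qform_shift BV (fun x => VG x Ga))// -(nehari_eq nw) -(lsum_shift a wp).
  by apply: eq_lsum => x; rewrite pairing_shift.
Qed.

Lemma nehari_cell : exists2 d, 0 < d & forall w, nehari w ->
  exists w', [/\ nehari w', I w' = I w &
    exists2 x, x \in cell & d <= `|phi (f x) (w' x)|].
Proof.
have [d d0 hd] := nehari_nonvanishing; exists d => // w nw.
have [x dx] := hd w nw; have [a Ga xa] := cellG x.
have [nw' Iw'] := nehari_shift Ga nw.
exists (fun z => w (z + a)); split; [exact: nw'|exact: Iw'|].
exists (x - a); first exact: xa.
have fE : f (x - a) = f x by rewrite -(fG (x - a) Ga) subrK.
by rewrite fE subrK.
Qed.

(** If [|y| <= k] the linear term suffices; otherwise the quotient [s * w x / y] exceeds [2 * M],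
    which bounds [y * w x] by the quadratic term. *)
Lemma ray_large w s M k : 0 < s -> 0 < M ->
  (forall x t, k < `|t| -> M < prim (f x) t / t ^+ 2) ->
  forall x, phi (f x) (s * w x) * w x <= `|k| * `|w x| + s / (2 * M) * w x ^+ 2.
Proof.
move=> s0 M0 hk x; set y := phi (f x) (s * w x).
have y0 : 0 <= y * w x by exact: (ray_ge0 nf sf x w s0).
have t0 : 0 <= s / (2 * M) * w x ^+ 2.
  by rewrite mulr_ge0 ?sqr_ge0// divr_ge0 ?mulr_ge0// ltW.
have t1 : 0 <= `|k| * `|w x| by rewrite mulr_ge0.
have [ky|yk] := ltP k `|y|; last first.
  rewrite (le_trans (ler_norm _))// normrM ler_wpDr// ler_wpM2r//.
  exact: le_trans yk (ler_norm _).
apply: le_trans (_ : s / (2 * M) * w x ^+ 2 <= _); last by rewrite lerDr.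
have [->|w0] := eqVneq (w x) 0; first by rewrite mulr0 expr0n mulr0.
have yn0 : y != 0.
  by rewrite /y (phi_eq0 (nf x) (sf x)) mulf_neq0// gt_eqF.
have := quot_gt_prim (nf x) yn0 (hk x y ky); rewrite /y (phiK (nf x) (sf x)) -/y => h.
have yw : 0 < y * w x by rewrite lt_neqAle y0 eq_sym mulf_neq0.
have : 2 * M * (y * w x) < s * w x / y * (y * w x) by rewrite ltr_pM2r.
have -> : s * w x / y * (y * w x) = s * w x ^+ 2 by field.
have -> : s / (2 * M) * w x ^+ 2 = s * w x ^+ 2 / (2 * M) by ring.
by rewrite ler_pdivlMr ?mulr_gt0// [y * w x * _]mulrC => /ltW.
Qed.

Lemma nehari_nonempty l : 0 < l -> spectrum (schrodinger V) l -> exists w, nehari w.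
Proof.
move=> l0 sl; have [z [s [zs Qz]]] := qform_pos_finite VK BV l0 sl.
have z2 : l2 z := l2_finite zs.
have zc : dual_class f z.
  by split=> //; apply: (@lsummable_finite _ _ s) => x /zs; rewrite /pairing => ->; rewrite mulr0.
have [x0 zx0] : exists x0, z x0 != 0.
  apply: contrapT => H; have z0 x : z x = 0.
    by apply/eqP; apply/negPn/negP => zx; apply: H; exists x.
  move: Qz; rewrite /qform /dot (_ : lsum _ = 0) ?ltxx//.
  by rewrite -[RHS](@lsum0 R N); apply: eq_lsum => x; rewrite z0 mulr0.
have zz0 : 0 < z x0 ^+ 2 by rewrite exprn_even_gt0.
have nz0 : 0 < `|z x0| by rewrite normr_gt0.
(* At a small scale the term at [x0] alone beats [s0 * Q z]: with [phi] equal to [y] there, this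
   amounts to [f x0 y / y <= z x0 ^+ 2 / Q z], true for small [y]. *)
have [d d0 hd] := f0u (divr_gt0 zz0 Qz).
pose y := d / 2 * (z x0 / `|z x0|).
have ny : `|y| = d / 2.
  rewrite /y normrM [`|z x0 / _|]normrM normfV normr_id divff ?gt_eqF// mulr1.
  by rewrite gtr0_norm// divr_gt0.
have y0 : y != 0 by rewrite -normr_gt0 ny divr_gt0.
have yz : y * z x0 = `|y| * `|z x0|.
  have zz : z x0 * z x0 = `|z x0| * `|z x0|.
    by rewrite -!expr2 real_normK// num_real.
  rewrite ny /y; have -> : d / 2 * (z x0 / `|z x0|) * z x0 =
    d / 2 * (z x0 * z x0 / `|z x0|) by ring.
  by rewrite zz mulfK ?gt_eqF.
pose s0 := f x0 y / z x0.
have s0z : s0 * z x0 = f x0 y by rewrite /s0 divfK.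
have yzp : 0 < y * z x0 by rewrite yz mulr_gt0// normr_gt0.
have s00 : 0 < s0.
  have := mulr_gt0 (mul_nl_gt0 (nf x0) y0) yzp; rewrite -s0z.
  have -> : s0 * z x0 * y * (y * z x0) = s0 * (y * z x0) ^+ 2 by ring.
  by rewrite pmulr_lgt0// exprn_gt0.
have small : s0 * Q z <= ray f z s0.
  have r0 := lsummable_ray nf sf s00 zc.2.
  apply: le_trans (ge0_le_lsum x0 (fun x => ray_ge0 nf sf x z s00) r0).
  rewrite s0z (nlK (nf x0) (sf x0)).
  have yd : `|y| < d by rewrite ny; lra.
  have sz : s0 * z x0 ^+ 2 = `|f x0 y| * `|z x0|.
    have fz : 0 < f x0 y * z x0 by rewrite -s0z -mulrA -expr2 mulr_gt0.
    by rewrite expr2 mulrA s0z -normrM gtr0_norm.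
  rewrite yz -(ler_pM2l zz0).
  have -> : z x0 ^+ 2 * (s0 * Q z) = Q z * (s0 * z x0 ^+ 2) by ring.
  have -> : z x0 ^+ 2 * (`|y| * `|z x0|) = Q z * (z x0 ^+ 2 / Q z * `|y| * `|z x0|).
    by field; rewrite gt_eqF.
  rewrite sz ler_pM2l// ler_wpM2r//. by apply: hd.
pose Z1 := lsum (fun x => `|z x|); pose Z2 := sqsum z.
have z1 : lsummable (fun x => `|z x|).
  by apply: (@lsummable_finite _ _ s) => x /zs ->; rewrite normr0.
have Z10 : 0 <= Z1 by apply: lsum_ge0.
have Z20 : 0 < Z2 by apply: lt_le_trans (le_sqsum x0 z2).
have M0 : 0 < Z2 / Q z by rewrite divr_gt0.
(* This threshold turns the quadratic term of [ray_large] into [s1 * Q z / 2]; the second entry of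
   the maximum below makes the linear term no larger. *)
have [k hk] := sfu (Z2 / Q z).
pose s1 := Num.max s0 (2 * `|k| * Z1 / Q z).
have s01 : s0 <= s1 by rewrite /s1 le_max lexx.
have s10 : 0 < s1 := lt_le_trans s00 s01.
have large : ray f z s1 <= s1 * Q z.
  apply: (@le_trans _ _ (`|k| * Z1 + s1 / (2 * (Z2 / Q z)) * Z2)).
    rewrite -!lsumZ// -lsumD; [|exact: lsummableZ|exact: lsummableZ].
    apply: le_lsum;
      [exact: (lsummable_ray nf sf s10 zc.2)|by apply: lsummableD; exact: lsummableZ|].
    exact: ray_large.
  have -> : s1 / (2 * (Z2 / Q z)) * Z2 = s1 * Q z / 2.
    by field; rewrite !gt_eqF.
  have : 2 * `|k| * Z1 / Q z <= s1 by rewrite /s1 le_max lexx orbT.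
  by rewrite ler_pdivrMr//; lra.
have [t _ nt] := nehari_on_ray BV nf sf zc (ex_intro _ x0 zx0) s00 s01 small large.
by exists (fun x => t * z x).
Qed.

End PeriodicNehari.

(** * Limits of minimizing sequences *)

Lemma continuous_lt0_near (R : realType) (h : R -> R) :
  {for 0, continuous h} -> h 0 < 0 ->
  exists2 r, 0 < r & forall e, `|e| < r -> h e < 0.
Proof.
move=> hc h0; have /cvgrPdist_lt/(_ (- h 0)) := hc.
rewrite oppr_gt0 => /(_ h0)/nbhs_ballP[r /= r0 hr]; exists r => // e er.
have := hr e; rewrite /ball /= sub0r normrN => /(_ er).
by rewrite ltr_distl => /andP[h1 h2]; lra.
Qed.

Section Limit.
Context {R : realType} {N : nat}.
Implicit Types u v w : lattice N -> R.
Local Notation L := (lattice N).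

Variables (V : L -> R) (K : R) (B : (L -> R) -> (L -> R)) (f : L -> R -> R).
Hypothesis VK : forall x, `|V x| <= K.
Hypothesis BV : inverse_op V B.
Hypothesis nf : forall x, nonlinearity (f x).
Hypothesis sf : forall x (M : R), exists K : R, forall t,
  K < `|t| -> M < prim (f x) t / t ^+ 2.

Local Notation Q := (qform B).
Local Notation nehari := (nehari B f).
Local Notation I := (dual_energy f).

Variables (U : set_system nat) (c : R) (w : nat -> L -> R) (wl ul : L -> R).
Hypothesis UU : UltraFilter U.
Hypothesis Uoo : \oo `<=` U.
Hypothesis c_min : forall v, nehari v -> c <= I v.
Hypothesis w_nehari : forall n, nehari (w n).
Hypothesis w_min : forall n, I (w n) <= c + n.+1%:R^-1.
Hypothesis w_cvg : forall x, w n x @[n --> U] --> wl x.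
Hypothesis u_cvg : forall x, B (w n) x @[n --> U] --> ul x.
Variable x0 : L.
Hypothesis wl0 : wl x0 != 0.

Let UP : ProperFilter U. Proof. exact: ultra_proper. Qed.

Lemma cvg_phi (T : Type) (F : set_system T) (FF : Filter F) x (t : T -> R) (t0 : R) :
  t @ F --> t0 -> phi (f x) (t n) @[n --> F] --> phi (f x) t0.
Proof. by move=> tt0; apply: continuous_cvg => //; exact: (phi_cont (nf x) (sf x)). Qed.

Section Site.
Variable a : L.
Local Notation k := (B (site a) a).

Let shifted n e : L -> R := fun x => w n x + e * site a x.

(* Bounds [ray - s * Q] at the perturbed point, by one term of a series of
   constant sign, in terms of the sites [x0] and [a] only. *)
Let X s t ta ua e : R :=
  phi (f x0) (s * t) * t - s * (phi (f x0) t * t) +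
  (phi (f a) (s * (ta + e)) * (ta + e) - phi (f a) (s * ta) * ta) -
  s * (2 * e * ua + e ^+ 2 * k).

Let Xn s n e := X s (w n x0) (w n a) (B (w n) a) e.
Let Xl s e := X s (wl x0) (wl a) (ul a) e.

Let Xn_cvg s e : Xn s n e @[n --> U] --> Xl s e.
Proof.
have sc (z : nat -> R) (z0 : R) : z @ U --> z0 -> (s * z n) @[n --> U] --> s * z0.
  by move=> zz; apply: cvgM; [exact: cvg_cst|].
have ac : (w n a + e) @[n --> U] --> wl a + e by apply: cvgD; [exact: w_cvg|exact: cvg_cst].
apply: cvgB; last first.
  apply: sc; apply: cvgD; last exact: cvg_cst.
  by apply: cvgM; [exact: cvg_cst|exact: u_cvg].
apply: cvgD; apply: cvgB.
- by apply: cvgM; [apply: cvg_phi; exact: sc|exact: w_cvg].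
- by apply: sc; apply: cvgM; [exact: cvg_phi|exact: w_cvg].
- by apply: cvgM; [apply: cvg_phi; exact: sc|].
- by apply: cvgM; [apply: cvg_phi; apply: sc; exact: w_cvg|exact: w_cvg].
Qed.

Let Xl_cont s : {for 0, continuous (Xl s)}.
Proof.
have ec : (wl a + e) @[e --> nbhs (0 : R)] --> wl a + 0.
  by apply: cvgD; [exact: cvg_cst|exact: cvg_id].
apply: cvgB.
  apply: cvgD; first exact: cvg_cst.
  apply: cvgB; last exact: cvg_cst.
  apply: cvgM => //; apply: cvg_phi.
  by apply: cvgM => //; exact: cvg_cst.
apply: cvgM; first exact: cvg_cst.
apply: cvgD; last first.
  by apply: cvgM; [|exact: cvg_cst]; apply: cvgM; exact: cvg_id.
by apply: cvgM; [|exact: cvg_cst]; apply: cvgM; [exact: cvg_cst|exact: cvg_id].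
Qed.

Let Xl0 s : Xl s 0 = phi (f x0) (s * wl x0) * wl x0 - s * (phi (f x0) (wl x0) * wl x0).
Proof. by rewrite /Xl /X addr0; ring. Qed.

Let ray_shifted n e s : 0 < s -> ray f (shifted n e) s - s * Q (shifted n e) =
  ray f (w n) s - s * lsum (pairing f (w n)) +
  (phi (f a) (s * (w n a + e)) * (w n a + e) - phi (f a) (s * w n a) * w n a) -
  s * (2 * e * B (w n) a + e ^+ 2 * k).
Proof.
move=> s0; have nw := w_nehari n.
have wc : dual_class f (w n) by split; [exact: nehari_l2 nw|exact: nehari_pairing nw].
rewrite (ray_site nf sf e a s0 wc) (qform_site VK BV)//; last exact: nehari_l2 nw.
rewrite (nehari_eq nw); ring.
Qed.

Let above n e s : 1 <= s -> ray f (shifted n e) s - s * Q (shifted n e) <= Xn s n e.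
Proof.
move=> s1; have s0 : 0 < s := lt_le_trans ltr01 s1.
rewrite ray_shifted// /Xn /X lerB// lerD2r.
exact: (ray_above nf sf x0 (nehari_pairing (w_nehari n))).
Qed.

Let below n e s : 0 < s -> s <= 1 -> Xn s n e <= ray f (shifted n e) s - s * Q (shifted n e).
Proof.
move=> s0 s1; rewrite ray_shifted// /Xn /X lerB// lerD2r.
exact: (ray_below nf sf x0 (nehari_pairing (w_nehari n))).
Qed.

(** The signs of [Xn] at [s0] and [s1] force a Nehari point between them on the perturbed ray;
    near-minimality of [w n] then leaves the error [n.+1%:R^-1]. *)
Let perturbed_scale n e s0 s1 : 0 < s0 -> s0 <= 1 -> 1 <= s1 ->
  0 < Xn s0 n e -> Xn s1 n e < 0 ->
  exists2 s, s0 <= s <= s1 &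
    0 <= n.+1%:R^-1 + (s * (e * phi (f a) (s * (w n a + e))) -
      s ^+ 2 * (e * B (w n) a + e ^+ 2 / 2 * k)).
Proof.
move=> s00 s01 s11 h0 h1.
have b0 := lt_le_trans h0 (below n e s00 s01).
have b1 := le_lt_trans (above n e s11) h1.
have wc : dual_class f (w n).
  by split; [exact: nehari_l2 (w_nehari n)|exact: nehari_pairing (w_nehari n)].
have zc : dual_class f (shifted n e) by exact: dual_class_site.
(* Were the perturbed point zero, its ray function would vanish at [s1], against the strict
   inequality [b1]. *)
have z0 : exists x, shifted n e x != 0.
  apply: contrapT => H; have z0 x : shifted n e x = 0.
    by apply/eqP; apply/negPn/negP => zx; apply: H; exists x.
  move: b1; rewrite /ray /qform /dot.
  rewrite [X in X - _](_ : _ = 0) ?[X in _ * X](_ : _ = 0) ?mulr0 ?subr0 ?ltxx//.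
    by rewrite -[RHS](@lsum0 R N); apply: eq_lsum => x; rewrite z0 mulr0.
  by rewrite -[RHS](@lsum0 R N); apply: eq_lsum => x; rewrite z0 mulr0.
have le0 : s0 * Q (shifted n e) <= ray f (shifted n e) s0 by rewrite -subr_ge0 ltW.
have le1 : ray f (shifted n e) s1 <= s1 * Q (shifted n e) by rewrite -subr_le0 ltW.
have [s ss nz] := nehari_on_ray BV nf sf zc z0 s00 (le_trans s01 s11) le0 le1.
exists s => //; have sp : 0 < s by move: ss => /andP[+ _]; exact: lt_le_trans.
have := le_trans (c_min nz) (nehari_perturb VK BV nf sf (w_nehari n) sp nz).
have := w_min n; move: (phi _ _) (B _ _) (B _ _) (I _) (n.+1%:R^-1) => p b1' b2' i d.
set t := s * (e * p); set r := s ^+ 2 * _; lra.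
Qed.

Let harmonic_cvg : (n.+1%:R^-1 : R) @[n --> U] --> (0 : R).
Proof. exact: cvg_trans (cvg_app _ Uoo) (@cvg_harmonic R). Qed.

(** Order of limits: [eta] is fixed first, then [e] is small enough for [Xl] to keep its signs at
    the two scales, strict because [wl x0 != 0], and [n] moves along [U] last. *)
Let limit_scale eta : 0 < eta -> eta < 1 -> exists2 r, 0 < r & forall e, `|e| < r ->
  exists2 s, 1 - eta <= s <= 1 + eta &
    0 <= e * (phi (f a) (s * (wl a + e)) - s * (ul a + e / 2 * k)).
Proof.
move=> e0 e1; have s00 : 0 < 1 - eta by rewrite subr_gt0.
have s01 : 1 - eta <= 1 by rewrite gerBl ltW.
have s11 : 1 <= 1 + eta by rewrite lerDl ltW.
have s1 : 1 < 1 + eta by rewrite ltrDl.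
have [r1 r10 hr1] : exists2 r, 0 < r & forall e, `|e| < r -> Xl (1 + eta) e < 0.
  apply: continuous_lt0_near; first exact: Xl_cont.
  by rewrite Xl0 subr_lt0; exact: (phi_scale_lt (nf x0) (sf x0)).
have [r2 r20 hr2] : exists2 r, 0 < r & forall e, `|e| < r -> - Xl (1 - eta) e < 0.
  apply: continuous_lt0_near; first by apply: cvgN; exact: Xl_cont.
  rewrite Xl0 oppr_lt0 subr_gt0.
  have ss : 1 < (1 - eta)^-1 by rewrite invf_gt1// gtrBl.
  have sw0 : (1 - eta) * wl x0 != 0 by rewrite mulf_neq0// gt_eqF.
  have := phi_scale_lt (nf x0) (sf x0) sw0 ss.
  rewrite mulKf ?gt_eqF//; set p := phi _ (wl x0); set q := phi _ _.
  have -> : p * ((1 - eta) * wl x0) = (1 - eta) * (p * wl x0) by ring.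
  by have -> : (1 - eta)^-1 * (q * ((1 - eta) * wl x0)) = q * wl x0
    by field; rewrite gt_eqF.
exists (Num.min r1 r2); first by rewrite lt_min r10.
move=> e; rewrite lt_min => /andP[er1 er2].
have n1 : \forall n \near U, Xn (1 + eta) n e < 0.
  by apply: (cvgr_lt (Xl (1 + eta) e)); [exact: Xn_cvg|exact: hr1].
have n2 : \forall n \near U, 0 < Xn (1 - eta) n e.
  apply: (cvgr_gt (Xl (1 - eta) e)); first exact: Xn_cvg.
  by rewrite -oppr_lt0 hr2.
pose D n s := 1 - eta <= s <= 1 + eta /\
  0 <= n.+1%:R^-1 + (s * (e * phi (f a) (s * (w n a + e))) -
      s ^+ 2 * (e * B (w n) a + e ^+ 2 / 2 * k)).
have nD : \forall n \near U, exists s, D n s.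
  apply: filterS2 n1 n2 => n h1 h2.
  by have [s ss hs] := perturbed_scale s00 s01 s11 h2 h1; exists s.
(* The scale defaults to 1 where none exists; this keeps the sequence bounded and leaves the limit
   along [U] unaffected. *)
have /choice[s hs] : forall n, exists s, 1 - eta <= s <= 1 + eta /\ ((exists s, D n s) -> D n s).
  move=> n; have [[s Ds]|nD'] := pselect (exists s, D n s).
    by exists s; split=> //; case: Ds.
  by exists 1; split=> //; rewrite s01.
have sb n : `|s n| <= 1 + eta.
  have [/andP[h1 h2] _] := hs n; rewrite ger0_norm// (le_trans _ h1)// ltW//.
have [sl _ scv] := ultra_bounded_cvg UU sb.
have sl0 : 1 - eta <= sl.
  by apply: (cvgr_to_ge scv); apply: nearW => n; have [/andP[]] := hs n.
have sl1 : sl <= 1 + eta.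
  by apply: (cvgr_to_le scv); apply: nearW => n; have [/andP[]] := hs n.
exists sl; first by rewrite sl0.
have lim : (n.+1%:R^-1 + (s n * (e * phi (f a) (s n * (w n a + e))) -
      s n ^+ 2 * (e * B (w n) a + e ^+ 2 / 2 * k))) @[n --> U] -->
   0 + (sl * (e * phi (f a) (sl * (wl a + e))) - sl ^+ 2 * (e * ul a + e ^+ 2 / 2 * k)).
  apply: cvgD; first exact: harmonic_cvg.
  apply: cvgB.
    apply: cvgM => //; apply: cvgM; first exact: cvg_cst.
    apply: cvg_phi; apply: cvgM => //; apply: cvgD; [exact: w_cvg|exact: cvg_cst].
  apply: cvgM; first by rewrite expr2; under eq_fun do rewrite expr2; exact: cvgM.
  apply: cvgD; last exact: cvg_cst.
  by apply: cvgM; [exact: cvg_cst|exact: u_cvg].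
have : 0 <= 0 + (sl * (e * phi (f a) (sl * (wl a + e))) - sl ^+ 2 * (e * ul a + e ^+ 2 / 2 * k)).
  apply: (cvgr_to_ge lim); apply: filterS nD => n Dn.
  by have [_ /(_ Dn)[]] := hs n.
have slp : 0 < sl := lt_le_trans s00 sl0.
rewrite add0r; set p := phi _ _.
have -> : sl * (e * p) - sl ^+ 2 * (e * ul a + e ^+ 2 / 2 * k) =
  sl * (e * (p - sl * (ul a + e / 2 * k))) by field.
by rewrite (pmulr_rge0 _ slp).
Qed.

(** Taking [e] with the sign [sg] and dividing by [|e|] gives one inequality for each sign; [eta]
    and [e] tend to 0 together, so the scale tends to 1. *)
Let limit_sign sg : `|sg| = 1 -> 0 <= sg * (phi (f a) (wl a) - ul a).
Proof.
move=> sg1.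
have /choice[es hes] : forall n : nat, exists es : R * R,
    [/\ `|es.1| <= n.+1%:R^-1, 1 - n.+2%:R^-1 <= es.2 <= 1 + n.+2%:R^-1 &
    0 <= sg * (phi (f a) (es.2 * (wl a + es.1)) - es.2 * (ul a + es.1 / 2 * k))].
  (* The shift by 2 gives [eta < 1] already at [n = 0]. *)
  move=> n; have eta0 : 0 < (n.+2%:R^-1 : R) by rewrite invr_gt0 ltr0n.
  have eta1 : (n.+2%:R^-1 : R) < 1 by rewrite invf_lt1 ?ltr0n// ltr1n.
  have [r r0 hr] := limit_scale eta0 eta1.
  pose d := Num.min (r / 2) n.+1%:R^-1.
  have d0 : 0 < d by rewrite lt_min divr_gt0//= invr_gt0 ltr0n.
  have nd : `|sg * d| = d by rewrite normrM sg1 mul1r gtr0_norm.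
  have [|s ss hs] := hr (sg * d).
    by rewrite nd (@le_lt_trans _ _ (r / 2)) ?ge_min ?lexx//; lra.
  exists (sg * d, s); split => //=; first by rewrite nd ge_min lexx orbT.
  by rewrite -(pmulr_rge0 _ d0) mulrA [d * sg]mulrC.
pose e n := (es n).1; pose s n := (es n).2.
have ec : e @ \oo --> (0 : R).
  apply/cvgr0Pnorm_le => d d0; near=> n.
  have [h _ _] := hes n; apply: le_trans h _.
  rewrite -[leLHS]ger0_norm ?invr_ge0//.
  by near: n; move: d d0; apply/cvgr0Pnorm_le; exact: cvg_harmonic.
have sc : s @ \oo --> (1 : R).
  apply/cvgrPdist_le => d d0; near=> n.
  have [_ h _] := hes n; rewrite distrC (@le_trans _ _ n.+1%:R^-1)//.
    have h3 : (n.+2%:R^-1 : R) <= n.+1%:R^-1 by rewrite lef_pV2 ?posrE ?ltr0n// ler_nat.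
    move: h; rewrite ler_distl -/(s n) => /andP[h1 h2].
    by rewrite (le_trans (lerB (lexx _) h3) h1) (le_trans h2)// lerD2l.
  rewrite -[leLHS]ger0_norm ?invr_ge0//.
  by near: n; move: d d0; apply/cvgr0Pnorm_le; exact: cvg_harmonic.
have lim : (sg * (phi (f a) (s n * (wl a + e n)) - s n * (ul a + e n / 2 * k))) @[n --> \oo] -->
    sg * (phi (f a) (1 * (wl a + 0)) - 1 * (ul a + 0 / 2 * k)).
  apply: cvgM; first exact: cvg_cst.
  apply: cvgB.
    by apply: cvg_phi; apply: cvgM => //; apply: cvgD => //; exact: cvg_cst.
  apply: cvgM => //; apply: cvgD; first exact: cvg_cst.
  by apply: cvgM; [|exact: cvg_cst]; apply: cvgM => //; exact: cvg_cst.
have : 0 <= sg * (phi (f a) (1 * (wl a + 0)) - 1 * (ul a + 0 / 2 * k)).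
  by apply: (cvgr_to_ge lim); apply: nearW => n; have [_ _] := hes n.
by rewrite !mul1r !mul0r !addr0.
Unshelve. all: by end_near. Qed.

Lemma minimizing_limit_critical : phi (f a) (wl a) = ul a.
Proof.
apply/eqP; rewrite -subr_eq0 eq_le.
have := limit_sign (normr1 _); have := limit_sign (normrN1 _).
by rewrite mulN1r mul1r oppr_ge0 => -> ->.
Qed.

End Site.
End Limit.

(** * Ground states *)

Section Periods.
Context {N : nat} {A : Type}.
Local Notation L := (lattice N).

Definition period (g : L -> A) (a : L) : Prop := forall x, g (x + a) = g x.

Lemma periodD g a b : period g a -> period g b -> period g (a + b).
Proof. by move=> ga gb x; rewrite addrA gb ga. Qed.

Lemma periodN g a : period g a -> period g (- a).
Proof. by move=> ga x; rewrite -(ga (x - a)) subrK. Qed.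

Lemma period0 g : period g 0.
Proof. by move=> x; rewrite addr0. Qed.

Lemma periodMz g a (m : int) : period g a -> period g (a *~ m).
Proof.
move=> ga; have nat_case n : period g (a *+ n).
  by elim: n => [|n IH]; [exact: period0|rewrite mulrS; exact: periodD].
by case: m => n; [exact: nat_case|rewrite NegzE mulrNz; apply/periodN/nat_case].
Qed.

Lemma lattice_period T (g : L -> A) (k : L) : lattice_periodic T g ->
  period g (k *+ T).
Proof.
move=> gT; have -> : k = \sum_(i < N) (delta_mx 0 i : L) *~ (k 0 i).
  rewrite [LHS](row_sum_delta k); apply: eq_bigr => i _.
  by rewrite -scaler_int intz.
rewrite -sumrMnl; apply: (big_ind (period g)).
- exact: period0.
- exact: periodD.
- by move=> i _; rewrite pmulrn mulrzAC; apply: periodMz => x; rewrite -pmulrn; exact: gT.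
Qed.

End Periods.

(** Coordinatewise remainders modulo [T] fill a finite cube. *)
Lemma finite_cell (N T : nat) : (0 < T)%N -> exists cell : seq (lattice N),
  forall x, exists2 a, (exists k : lattice N, a = k *+ T) & x - a \in cell.
Proof.
move=> T0.
exists (codom (fun g : {ffun 'I_N -> 'I_T} => \row_i (g i : nat)%:Z : lattice N)) => x.
exists ((\row_i divz (x 0 i) T : lattice N) *+ T); first by eexists.
have m0 i : 0 <= modz (x 0 i) T by rewrite modz_ge0// eqz_nat -lt0n.
have mT i : (absz (modz (x 0%R i) T) < T)%N.
  by rewrite -ltz_nat gez0_abs// ltz_pmod// ltz_nat.
apply/codomP; exists [ffun i => Ordinal (mT i)]; apply/rowP => i.
rewrite !mxE ffunE /= gez0_abs//.
rewrite {1}(divz_eq (x 0 i) T) mulmxnE mxE -mulr_natr.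
by rewrite addrAC natz subrr add0r.
Qed.

Section Ground.
Context {R : realType} {N : nat}.
Local Notation L := (lattice N).

(** Testing the equation with [u] turns the quadratic part into half the sum of [f(x,u) u]; as the
    density is nonnegative, this also dominates [prim] and makes it summable. *)
Lemma energy_solution (V : L -> R) (K : R) (f : L -> R -> R) (u : L -> R) B :
  (forall x, `|V x| <= K) -> (forall x, nonlinearity (f x)) ->
  (forall x (M : R), exists K : R, forall t, K < `|t| -> M < prim (f x) t / t ^+ 2) ->
  inverse_op V B -> l2 u -> (exists x, u x != 0) ->
  (forall x, schrodinger V u x = f x (u x)) ->
  energy V f u = dual_energy f (fun x => f x (u x)).
Proof.
move=> VK nf sf BV us u0 eqn.
have [nw _] := nehari_of_solution VK BV nf sf us u0 eqn.
have pE x : pairing f (fun x => f x (u x)) x = schrodinger V u x * u x.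
  by rewrite /pairing (nlK (nf x) (sf x)) eqn mulrC.
have ps : lsummable (fun x => 2^-1 * (schrodinger V u x * u x)).
  by apply: lsummableZ; apply: eq_lsummable (nehari_pairing nw).
have dE x : dual_density (f x) (f x (u x)) = 2^-1 * (schrodinger V u x * u x) - prim (f x) (u x).
  by rewrite (dual_densityE (nf x) (sf x)) -pE /pairing (nlK (nf x) (sf x)).
have prims : lsummable (fun x => prim (f x) (u x)).
  apply: ge0_le_lsummable ps => x; rewrite prim_ge0//=.
  by rewrite -subr_ge0 -dE; exact: dual_density_ge0.
rewrite /dual_energy (eq_lsum dE) lsumB// lsumZ; last exact: (l2M (l2_schrodinger VK us) us).
by rewrite -/(dot _ _) -(lsum_energy VK us).
Qed.

End Ground.

Theorem theorem1p1 (R : realType) (N T : nat) (hN : (1 <= N)%N) (hT : (1 <= T)%N)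
    (V : lattice N -> R) (f : lattice N -> R -> R)
    (V_bounded : bounded_fun V)
    (V_periodic : lattice_periodic T V)
    (V_gap : zero_in_spectral_gap V)
    (f_continuous : forall x, continuous (f x))
    (f_periodic : forall t, lattice_periodic T (fun x => f x t))
    (f_growth : exists a p : R, [/\ 0 < a, 2 < p &
       forall x t, `|f x t| <= a * (`|t| + `|t| `^ (p - 1))])
    (f_zero : forall e : R, 0 < e -> exists2 d : R, 0 < d &
       forall x t, `|t| < d -> `|f x t| <= e * `|t|)
    (F_superquadratic : forall M : R, exists K : R,
       forall x t, K < `|t| -> M < primitive f x t / t ^+ 2)
    (f_mono_neg : forall x s t, s < t -> t < 0 -> f x s / `|s| < f x t / `|t|)
    (f_mono_pos : forall x s t, 0 < s -> s < t -> f x s / `|s| < f x t / `|t|) :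
  exists u : lattice N -> R, ground_state V f u.
Proof.
have [K [_ VM]] := V_bounded.
(* [bounded_fun] provides the bound at values strictly above [K]. *)
have VK x : `|V x| <= K + 1 by apply: VM => //; rewrite ltrDl.
have nf x : nonlinearity (f x).
  split=> //; [|exact: f_mono_neg|exact: f_mono_pos].
  by move=> e /f_zero[d d0 hd]; exists d => // t; exact: hd.
have fb (k : R) : exists k', forall x t, `|t| <= k -> `|f x t| <= k'.
  have [a [p [a0 p2 hf]]] := f_growth; exists (a * (k + k `^ (p - 1))) => x t tk.
  apply: le_trans (hf x t) _; rewrite ler_pM2l// lerD//.
  have k0 : 0 <= k := le_trans (normr_ge0 _) tk.
  by apply: ge0_ler_powR; rewrite ?nnegrE//; lra.
have sfu (m : R) : exists k : R, forall x t, k < `|t| -> m < prim (f x) t / t ^+ 2.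
  exact: F_superquadratic.
have sf := superquadratic_at sfu.
have [s0 _ [l l0 sl]] := V_gap.
have [B BV] := resolvent_inverse_op s0.
have [cell hcell] := finite_cell N hT.
pose G := [set a : lattice N | exists k : lattice N, a = k *+ T].
have VG (a x : lattice N) : G a -> V (x + a) = V x.
  by move=> [k ->]; exact: lattice_period.
have fG (a x : lattice N) : G a -> f (x + a) = f x.
  by move=> [k ->]; apply/funext => t; exact: (@lattice_period _ _ T (fun x => f x t)).
pose E := [set z : R | exists2 w, nehari B f w & z = dual_energy f w].
have E_inf : has_inf E.
  split; last first.
    by exists 0 => _ [w _ ->]; apply: lsum_ge0 => x; exact: dual_density_ge0.
  have [w nw] := nehari_nonempty VK BV nf f_zero sfu l0 sl.
  by exists (dual_energy f w), w.
pose c := inf E.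
have c_min w : nehari B f w -> c <= dual_energy f w.
  by move=> nw; apply: ge_inf; [exact: E_inf.2|exists w].
have [d d0 hd] := nehari_cell BV nf f_zero sfu VG fG hcell.
have /choice[w hw] : forall n : nat, exists w : lattice N -> R,
    [/\ nehari B f w, dual_energy f w <= c + n.+1%:R^-1 &
      exists2 x, x \in cell & d <= `|phi (f x) (w x)|].
  move=> n; have n0 : 0 < (n.+1%:R^-1 : R) by rewrite invr_gt0.
  have [_ [v nv ->] vc] := inf_adherent n0 E_inf.
  have [w [nw wv hx]] := hd v nv.
  by exists w; split; [exact: nw|rewrite wv; exact: ltW|exact: hx].
have nw n : nehari B f (w n) by have [] := hw n.
have wc n : dual_energy f (w n) <= c + n.+1%:R^-1 by have [] := hw n.
have [S hS] := nehari_l2_bound BV nf f_zero fb sfu fG hcell (c + 1).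
have wS n : sqsum (w n) <= S.
  apply: hS; first exact: nw.
  by apply: le_trans (wc n) _; rewrite lerD2l invf_le1 ?ltr0n// ler1n.
have [C C0 BC] := inv_bd BV.
have uS n : sqsum (B (w n)) <= C * S.
  by apply: le_trans (BC _ (nehari_l2 (nw n))) _; rewrite ler_wpM2l.
have [U UU Uoo] := ultrafilter_nat.
have UP : ProperFilter U by exact: ultra_proper.
have [wl [wls _ wcv]] := l2_ultralimit UU (fun n => nehari_l2 (nw n)) wS.
have [ul [uls _ ucv]] := l2_ultralimit UU (fun n => inv_l2 BV (nehari_l2 (nw n))) uS.
(* The local equation [A (B (w n)) = w n] is passed to the limit, rather than the nonlocal [B]. *)
have Aul x : schrodinger V ul x = wl x.
  have c1 : schrodinger V (B (w n)) x @[n --> U] --> schrodinger V ul x.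
    exact: schrodinger_cvg.
  have c2 : schrodinger V (B (w n)) x @[n --> U] --> wl x.
    under eq_fun do rewrite (inv_r BV _ (nehari_l2 (nw _))).
    exact: wcv.
  exact: (cvg_unique _ c1 c2).
have [x0 wl0] : exists x0, wl x0 != 0.
  apply: contrapT => H; have z0 x : wl x = 0.
    by apply/eqP; apply/negPn/negP => wx; apply: H; exists x.
  (* The site of the lower bound [d] varies with [n] inside the finite cell; summing over the cell
     avoids selecting one. *)
  have lim : (\sum_(x <- cell) `|phi (f x) (w n x)|) @[n --> U] -->
      \sum_(x <- cell) `|phi (f x) (wl x)|.
    apply: cvg_sum_seq => x; apply: cvg_norm; apply: (cvg_phi nf sf); exact: wcv.
  have : d <= \sum_(x <- cell) `|phi (f x) (wl x)|.
    apply: (cvgr_to_ge lim); apply: nearW => n; have [_ _ [x xc dx]] := hw n.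
    by apply: le_trans dx _; rewrite (big_rem x)//= lerDl sumr_ge0.
  by rewrite big1 ?leNgt ?d0// => x _; rewrite z0 (phi0 (nf x) (sf x)) normr0.
have crit x : phi (f x) (wl x) = ul x.
  exact: (minimizing_limit_critical VK BV nf sf UU Uoo c_min nw wc wcv ucv wl0).
have fu x : f x (ul x) = wl x by rewrite -crit (phiK (nf x) (sf x)).
have eqn x : schrodinger V ul x = f x (ul x) by rewrite Aul fu.
have ul0 : exists x, ul x != 0.
  by exists x0; rewrite -crit (phi_eq0 (nf x0) (sf x0)).
have low : energy V f ul <= c.
  rewrite (energy_solution VK nf sf BV uls ul0 eqn).
  have cc : (c + n.+1%:R^-1) @[n --> U] --> c + 0.
    apply: cvgD; first exact: cvg_cst.
    exact: cvg_trans (cvg_app _ Uoo) (@cvg_harmonic R).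
  have [||||_] := @lsum_fatou R N U UP (fun n x => dual_density (f x) (w n x))
    (fun x => dual_density (f x) (f x (ul x))) _ _ _ _ _ cc.
  - by move=> n x; exact: dual_density_ge0.
  - by move=> n; apply: (lsummable_dual_density nf sf); exact: nehari_pairing (nw n).
  - exact: wc.
  - move=> x; rewrite fu; apply: continuous_cvg; last exact: wcv.
    exact: (dual_density_cont (nf x) (sf x)).
  - by rewrite addr0.
exists ul; split.
- by split; [exact/W12P|exact: eqn].
- by move=> ulE; have [x] := ul0; rewrite ulE eqxx.
- move=> v [/W12P vs veq] vn0; apply: le_trans low _.
  have v0 : exists x, v x != 0.
    apply: contrapT => H; apply: vn0; apply/funext => x.
    by apply/eqP; apply/negPn/negP => vx; apply: H; exists x.
  rewrite (energy_solution VK nf sf BV vs v0 veq).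
  by apply: c_min; have [] := nehari_of_solution VK BV nf sf vs v0 veq.
Qed.
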